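(* Let $\Omega_1$ be the partial functional on subsets $X\subseteq\mathbb N^{\mathbb N}$ which is defined exactly when $X=\{x\}$ for some $x$, with $\Omega_1(X)=x$, and let $\mathsf S^2$ be the Suslin functional. Then: (a) If $A\subset\mathbb N$ is computable by an infinite time Turing machine (ITTM), then $A$ is computable from $\Omega_1$ and $\mathsf S^2$. (b) The halting problem for ITTMs is computable in $\Omega_1$ and $\mathsf S^2$.
   Context: The Suslin functional $\mathsf S^2:\mathbb N^{\mathbb N}\to\{0,1\}$ is defined by $\mathsf S^2(f)=0$ iff there is $g\in\mathbb N^{\mathbb N}$ with $f(\overline g n)=0$ for all $n\in\mathbb N$, where $\overline g n$ is (the code of) the finite sequence $\langle g(0),\dots,g(n-1)\rangle$. ITTMs are the usual infinite time Turing machines with transfinite ordinal running times; the halting problem is the set of pairs consisting of (a number code of) an ITTM and an integer input on which it halts. Subsets of $\mathbb N$ and $\mathbb N^{\mathbb N}$ are given by characteristic functions. Types: $0$ is a type of rank $0$; if $\sigma_1,\dots,\sigma_n$ ($n\ge 1$) are types, then $(\sigma_1,\dots,\sigma_n\to 0)$ is a type of rank $\max_i(\mathrm{rank}(\sigma_i)+1)$. Put $F(0)=\mathbb N$ and let $F(\sigma_1,\dots,\sigma_n\to 0)$ be the set of all total functions $F(\sigma_1)\times\cdots\times F(\sigma_n)\to\mathbb N$. Let $P(\sigma_1,\dots,\sigma_n\to 0)$ be the set of all functions $F(\sigma_1)\times\cdots\times F(\sigma_n)\to\mathbb N\cup\{\bot\}$, where $\bot$ means undefined (partial functionals, applied only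 to total arguments). Functionals with values in $\mathbb N^{\mathbb N}$ are viewed as $\mathbb N$-valued functionals with an extra number argument. Computability: Kleene's S1–S9, where partial functionals of type rank $\le 3$ are allowed as oracles. That is, $\{e\}(\vec\phi)\simeq a$ is the least relation closed under Kleene's schemes: successor, constants, projection to a number argument, composition, primitive recursion, permutation of arguments, application of an argument, and S9: $\{e\}(m,\vec\phi,\vec\psi)\simeq\{m\}(\vec\phi)$. An application $\phi_i(\lambda\vec\xi_1.\{d_1\}(\vec\xi_1,\vec\phi),\dots,\lambda\vec\xi_k.\{d_k\}(\vec\xi_k,\vec\phi))$ has value $a\in\mathbb N$ iff all the displayed functionals are total (on total arguments) and $\phi_i$ applied to them equals $a$. A partial functional $\psi$ is computable in $\vec\phi$ if for some $e$, $\{e\}(\vec\xi,\vec\phi)\simeq\psi(\vec\xi)$ for all total $\vec\xi$ with $\psi(\vec\xi)\ne\bot$. *)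

(* Defs.v *)
From mathcomp Require Import all_boot.
From mathcomp Require Import boolp wochoice.

Set Implicit Arguments.
Unset Strict Implicit.
Unset Printing Implicit Defensive.

(** * Finite types, total and partial functionals *)

(* Curried presentation: (s1, ..., sn -> 0) is s1 ⟶ (s2 ⟶ ... (sn ⟶ 0)), and
   every type other than [tnat] has this form for exactly one nonempty list
   s1, ..., sn. *)
Inductive ftype := tnat | tarr of ftype & ftype.
Notation "s ⟶ t" := (tarr s t) (at level 55, right associativity).

Fixpoint rank (t : ftype) : nat :=
  if t is s ⟶ t' then maxn (rank s).+1 (rank t') else 0.

(* F(t) *)
Fixpoint ftotal (t : ftype) : Type :=
  if t is s ⟶ t' then ftotal s -> ftotal t' else nat.

(* P(t) for t of the form s ⟶ t'; [None] stands for "undefined". *)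
Fixpoint fpartial (t : ftype) : Type :=
  if t is s ⟶ t' then ftotal s -> fpartial t' else option nat.

(* The product F(s1) * ... * F(sn), for t = (s1, ..., sn -> 0). *)
Fixpoint ftuple (t : ftype) : Type :=
  if t is s ⟶ t' then (ftotal s * ftuple t')%type else unit.

Fixpoint tapp (t : ftype) : ftotal t -> ftuple t -> nat :=
  match t return ftotal t -> ftuple t -> nat with
  | tnat => fun a _ => a
  | s ⟶ t' => fun f xi => tapp (f xi.1) xi.2
  end.

Fixpoint papp (t : ftype) : fpartial t -> ftuple t -> option nat :=
  match t return fpartial t -> ftuple t -> option nat with
  | tnat => fun a _ => a
  | s ⟶ t' => fun f xi => papp (f xi.1) xi.2
  end.

Fixpoint to_partial (t : ftype) : ftotal t -> fpartial t :=
  match t return ftotal t -> fpartial t with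
  | tnat => fun a => Some a
  | s ⟶ t' => fun f x => to_partial (f x)
  end.

Record functional := Functional { ftyp : ftype; fval : ftotal ftyp }.

Fixpoint components (t : ftype) : ftuple t -> seq functional :=
  match t return ftuple t -> seq functional with
  | tnat => fun=> [::]
  | s ⟶ t' => fun xi => Functional xi.1 :: components xi.2
  end.

(** * Kleene computability *)

Inductive arg :=
| ArgN of nat
| ArgF (s t : ftype) of fpartial (s ⟶ t).

Definition total_arg (f : functional) : arg :=
  let: Functional t x := f in
  match t return ftotal t -> arg with
  | tnat => fun n => ArgN n
  | s ⟶ t' => fun g => ArgF (@to_partial (s ⟶ t') g)
  end x.

Definition args (t : ftype) (xi : ftuple t) : seq arg :=
  map total_arg (components xi).

(* [kleene e phi a] is {e}(phi) ~ a.  Indices code the scheme and its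
   parameters as finite sequences of numbers; they do not record the types of
   the arguments.  Kleene's S7 and S8 are both instances of [S8].  If the j-th
   argument type of phi_i is 0 then xi is empty in the premise of [S8], so that
   {d_j}(phi) is a number. *)
Inductive kleene : nat -> seq arg -> nat -> Prop :=
| S1 x phi :
    kleene (CodeSeq.code [:: 1]) (ArgN x :: phi) x.+1
| S2 q phi :
    kleene (CodeSeq.code [:: 2; q]) phi q
| S3 x phi :
    kleene (CodeSeq.code [:: 3]) (ArgN x :: phi) x
| S4 d1 d2 phi b a :
    kleene d2 phi b -> kleene d1 (ArgN b :: phi) a ->
    kleene (CodeSeq.code [:: 4; d1; d2]) phi a
| S5_0 d1 d2 phi a :
    kleene d1 phi a ->
    kleene (CodeSeq.code [:: 5; d1; d2]) (ArgN 0 :: phi) a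
| S5_S d1 d2 x phi b a :
    kleene (CodeSeq.code [:: 5; d1; d2]) (ArgN x :: phi) b ->
    kleene d2 [:: ArgN x, ArgN b & phi] a ->
    kleene (CodeSeq.code [:: 5; d1; d2]) (ArgN x.+1 :: phi) a
| S6 d pi phi a :
    perm_eq pi (iota 0 (size phi)) ->
    kleene d [seq nth (ArgN 0) phi i | i <- pi] a ->
    kleene (CodeSeq.code [:: 6, d & pi]) phi a
| S8 i ds phi s t (f : fpartial (s ⟶ t)) (psi : ftuple (s ⟶ t)) a :
    nth (ArgN 0) phi i = ArgF f ->
    size ds = size (components psi) ->
    (forall j, j < size ds ->
       let psi_j := nth (@Functional tnat 0) (components psi) j in
       forall xi : ftuple (ftyp psi_j),
         kleene (nth 0 ds j) (args xi ++ phi) (tapp (fval psi_j) xi)) ->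
    papp f psi = Some a ->
    kleene (CodeSeq.code [:: 8, i & ds]) phi a
| S9 m phi psi a :
    kleene m phi a ->
    kleene (CodeSeq.code [:: 9; size phi]) (ArgN m :: phi ++ psi) a.

Record oracle := Oracle {
  odom : ftype;
  ocod : ftype;
  ofun : fpartial (odom ⟶ ocod);
  orank : rank (odom ⟶ ocod) <= 3
}.

Definition oracle_arg (o : oracle) : arg := ArgF (@ofun o).

Definition computable_in (s t : ftype) (psi : fpartial (s ⟶ t))
    (phi : seq oracle) : Prop :=
  exists e : nat, forall (xi : ftuple (s ⟶ t)) (a : nat),
    papp psi xi = Some a -> kleene e (args xi ++ map oracle_arg phi) a.

(** * The functionals S^2 and Omega_1 *)

Definition suslin_fun (f : nat -> nat) : nat :=
  if `[< exists g : nat -> nat, forall n, f (CodeSeq.code (mkseq g n)) = 0 >]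
  then 0 else 1.

Definition S2_type := (tnat ⟶ tnat) ⟶ tnat.

Definition suslin : oracle :=
  @Oracle _ _ (@to_partial S2_type suslin_fun) (isT : rank S2_type <= 3).

(* X is the characteristic function of {x}. *)
Definition is_singleton (X : (nat -> nat) -> nat) (x : nat -> nat) : Prop :=
  forall y, X y = `[< y = x >].

Definition Omega1_fun (X : (nat -> nat) -> nat) (n : nat) : option nat :=
  match pselect (exists x, is_singleton X x) with
  | left h => Some (projT1 (cid h) n)
  | right _ => None
  end.

Definition Omega1_type := ((tnat ⟶ tnat) ⟶ tnat) ⟶ tnat ⟶ tnat.

Definition Omega1 : oracle :=
  @Oracle _ _ (Omega1_fun : fpartial Omega1_type)
    (isT : rank Omega1_type <= 3).

(** * Infinite time Turing machines *)

(* Hamkins-Lewis machines: an input, a scratch and an output tape, with cells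
   indexed by nat, and one head reading the same position on all three. *)
Definition symbol := (bool * bool * bool)%type.

(* States 0, 1, 2 are the start, limit and halt states.  The last component of
   a transition is the move of the head, [true] meaning right. *)
Record ittm := Ittm {
  nst : nat;
  delta : 'I_nst.+3 -> symbol -> 'I_nst.+3 * symbol * bool
}.

Definition start_state (M : ittm) : 'I_(nst M).+3 := inord 0.
Definition limit_state (M : ittm) : 'I_(nst M).+3 := inord 1.
Definition halt_state (M : ittm) : 'I_(nst M).+3 := inord 2.

Record config (M : ittm) := Config {
  state : 'I_(nst M).+3;
  pos : nat;
  input : nat -> bool;
  scratch : nat -> bool;
  output : nat -> bool
}.

Definition write (T : nat -> bool) (k : nat) (b : bool) : nat -> bool :=
  fun i => if i == k then b else T i.

(* A left move on cell 0 leaves the head there. *)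
Definition step (M : ittm) (c : config M) : config M :=
  let k := pos c in
  let: (q, (a, b, d), move) :=
    delta (state c) (input c k, scratch c k, output c k) in
  @Config M q (if move then k.+1 else k.-1)
    (write (input c) k a) (write (scratch c) k b) (write (output c) k d).

Definition numeral (n : nat) : nat -> bool := fun i => i < n.

Definition initial (M : ittm) (n : nat) : config M :=
  Config (start_state M) 0 (numeral n) xpred0 xpred0.

(* Ordinals are represented as the positions in a well-order (W, R), where [R]
   is the non-strict order. *)
Section Runs.
Variables (W : Type) (R : rel W).

Definition below (a b : W) : Prop := ~~ R b a.

Definition is_zero (a : W) : Prop := forall b, ~ below b a.

Definition is_succ (a b : W) : Prop :=
  below a b /\ forall c, ~ (below a c /\ below c b).

Definition is_limit (l : W) : Prop :=
  ~ is_zero l /\ forall a, ~ is_succ a l.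

(* The limsup of a cell at a limit l: the value is 1 iff it is 1 cofinally
   often below l. *)
Definition limit_tape (l : W) (T : W -> nat -> bool) : nat -> bool :=
  fun i => `[< forall b, below b l ->
                 exists c, [/\ below b c, below c l & T c i] >].

Definition is_run (M : ittm) (n : nat) (r : W -> config M) : Prop :=
  [/\ forall a, is_zero a -> r a = initial M n,
      forall a b, is_succ a b -> r b = step (r a) &
      forall l, is_limit l ->
        r l = Config (limit_state M) 0
                (limit_tape l (fun a => input (r a)))
                (limit_tape l (fun a => scratch (r a)))
                (limit_tape l (fun a => output (r a)))].

End Runs.

(* M on input n reaches its halt state for the first time with T on the output
   tape. *)
Definition halts_with (M : ittm) (n : nat) (T : nat -> bool) : Prop :=
  exists (W : Type) (R : rel W) (r : W -> config M) (h : W),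
    [/\ well_order R, is_run R n r,
        forall a, below R a h -> state (r a) <> halt_state M,
        state (r h) = halt_state M & output (r h) = T].

Definition halts (M : ittm) (n : nat) : Prop := exists T, halts_with M n T.

Definition ittm_computable (A : nat -> bool) : Prop :=
  exists M : ittm, forall n, halts_with M n (numeral (A n)).

Definition bits : seq bool := [:: false; true].
Definition symbols : seq symbol :=
  [seq (p, c) | p <- [seq (a, b) | a <- bits, b <- bits], c <- bits].

Definition transition_code (k : nat) (x : 'I_k * symbol * bool) : nat :=
  let: (q, (a, b, c), move) := x in
  CodeSeq.code [:: nat_of_ord q; a : nat; b : nat; c : nat; move : nat].

Definition ittm_code (M : ittm) : nat :=
  CodeSeq.code (nst M ::
    [seq transition_code (delta q x) | q <- enum 'I_(nst M).+3, x <- symbols]).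

Definition ittm_halting (e n : nat) : Prop :=
  exists M : ittm, ittm_code M = e /\ halts M n.

(** * Characteristic functions, as functionals of types 1 and (0, 0 -> 0) *)

Definition char1 (A : nat -> bool) : fpartial (tnat ⟶ tnat) :=
  fun n => Some (A n : nat).

Definition char2 (B : nat -> nat -> Prop) : fpartial (tnat ⟶ tnat ⟶ tnat) :=
  fun m n => Some (`[< B m n >] : nat).

(* Main.v *)
Require Import Defs.
From mathcomp Require Import all_boot.
From mathcomp Require Import boolp wochoice.
From mathcomp Require Import zify.

(* By determinism a run of a machine is an abstract transfinite iteration on
   configurations in N^N.  On a well-order in which countable sequences are
   bounded, some limit configurations b < a of the run coincide while no cell
   that is 0 at b becomes nonzero in between, so the run halts or repeats
   forever from b on, and there is a first position at which one of these is
   witnessed.  The structure consisting of the run up to that position has a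
   suborder that is closed under a few definable Skolem functions; the
   restriction of the run to it is again a run with the same kind of end, hence
   isomorphic to the whole by minimality.  So every position is named by a term,
   and the terms (coded by natural numbers) preordered by their values, together
   with the configurations at these values, form a canonical element of N^N.
   The set consisting of this element is arithmetical except for one
   well-foundedness condition, hence decidable with S^2, and Omega_1 then yields
   the element itself, from which the outcome of the computation is read off. *)

Set Implicit Arguments.
Unset Strict Implicit.
Unset Printing Implicit Defensive.

(** * Contexts of arguments and computability *)

(** The number of arguments is constant in a context, so the positions that S6, S8 and S9 refer to,
    in particular those of the oracles behind the prefix, do not depend on the element [g]. *)
Record ctx := Ctx {
  csort :> Type;
  prefix_args : csort -> seq arg;
  nprefix : nat;
  size_prefix_args : forall g, size (prefix_args g) = nprefix
}.

Definition cargs (c : ctx) (g : c) : seq arg :=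
  prefix_args g ++ map oracle_arg [:: Omega1; suslin].

Definition computable (c : ctx) (F : c -> nat) := exists e, forall g, kleene e (cargs g) (F g).

Definition is_fvar (c : ctx) (Y : c -> nat -> nat) :=
  exists i, forall g, nth (ArgN 0) (cargs g) i = ArgF (@to_partial (tnat ⟶ tnat) (Y g)).

Definition ctx0 : ctx := @Ctx unit (fun=> [::]) 0 (fun=> erefl).

Lemma size_push_args (A : Type) (f : A -> arg) (c : ctx) (p : A * c) :
  size (f p.1 :: prefix_args p.2) = (nprefix c).+1.
Proof. by rewrite /= size_prefix_args. Qed.

Definition push (A : Type) (f : A -> arg) (c : ctx) : ctx :=
  @Ctx (A * c)%type _ _ (@size_push_args A f c).

Definition npush := push ArgN.
Definition fpush := push (fun y : nat -> nat => ArgF (@to_partial (tnat ⟶ tnat) y)).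

Lemma size_cargs (c : ctx) (g : c) : size (cargs g) = (nprefix c).+2.
Proof. by rewrite size_cat size_prefix_args addn2. Qed.

Lemma nth_cargs_oracle (c : ctx) (g : c) i :
  nth (ArgN 0) (cargs g) (nprefix c + i) = nth (ArgN 0) (map oracle_arg [:: Omega1; suslin]) i.
Proof. by rewrite nth_cat size_prefix_args ltnNge leq_addr addKn. Qed.

Lemma comp_ext (c : ctx) (F G : c -> nat) : F =1 G -> computable F -> computable G.
Proof. by move=> FG [e He]; exists e => g; rewrite -FG. Qed.

Lemma comp_const (c : ctx) q : computable (fun _ : c => q).
Proof. by exists (CodeSeq.code [:: 2; q]) => g; apply: S2. Qed.

Lemma comp_let (c : ctx) (G : c -> nat) (F : npush c -> nat) :
  computable G -> computable F -> computable (fun g => F (G g, g)).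
Proof.
move=> [d2 H2] [d1 H1]; exists (CodeSeq.code [:: 4; d1; d2]) => g.
exact: (S4 (H2 g) (H1 (G g, g))).
Qed.

Lemma comp_var0 (c : ctx) : computable (fun p : npush c => p.1).
Proof. by exists (CodeSeq.code [:: 3]) => -[x g]; apply: S3. Qed.

Lemma comp_succ (c : ctx) (G : c -> nat) : computable G -> computable (fun g => (G g).+1).
Proof.
move=> HG; apply: (comp_let (F := fun p => p.1.+1) HG).
by exists (CodeSeq.code [:: 1]) => -[x g]; apply: S1.
Qed.

(* The new argument is rotated to the end by S6 and then dropped by S9. *)
Lemma comp_push (A : Type) (f : A -> arg) (c : ctx) (F : c -> nat) :
  computable F -> computable (fun p : push f c => F p.2).
Proof.
move=> [e He]; pose n := (nprefix c).+2.
pose d1 := CodeSeq.code [:: 9; n]; pose d2 := CodeSeq.code [:: 2; e].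
exists (CodeSeq.code [:: 6, CodeSeq.code [:: 4; d1; d2] & rot 1 (iota 0 n.+1)]).
move=> [x g]; have sz : size (cargs ((x, g) : push f c)) = n.+1 by rewrite size_cargs.
apply: S6; first by rewrite sz perm_rot.
have -> : [seq nth (ArgN 0) (cargs ((x, g) : push f c)) i | i <- rot 1 (iota 0 n.+1)]
    = cargs g ++ [:: f x].
  by rewrite map_rot -sz map_nth_iota0 // take_size /cargs /= rot1_cons -cats1.
apply: (S4 (b := e)); first exact: S2.
have -> : d1 = CodeSeq.code [:: 9; size (cargs g)] by rewrite size_cargs.
exact/S9/He.
Qed.

Lemma comp_wk (c : ctx) (F : c -> nat) : computable F -> computable (fun p : npush c => F p.2).
Proof. exact: comp_push. Qed.

Lemma comp_fwk (c : ctx) (F : c -> nat) : computable F ->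
  computable (fun p : fpush c => F p.2).
Proof. exact: comp_push. Qed.

Lemma comp_swap (c : ctx) (F : npush (npush c) -> nat) :
  computable F -> computable (fun p : npush (npush c) => F (p.2.1, (p.1, p.2.2))).
Proof.
move=> [e He]; pose n := (nprefix c).+2.
exists (CodeSeq.code [:: 6, e, 1, 0 & iota 2 n]) => -[x [y g]].
have sz : size (cargs ((x, (y, g)) : npush (npush c))) = n.+2 by rewrite size_cargs.
apply: S6; first by rewrite sz; exact/permPl/(perm_catCA [:: 1] [:: 0]).
have -> : [seq nth (ArgN 0) (cargs ((x, (y, g)) : npush (npush c))) i | i <- [:: 1,
  0 & iota 2 n]]
    = cargs ((y, (x, g)) : npush (npush c)).
  have -> : n = size (cargs g) by rewrite size_cargs.
  rewrite !map_cons.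
  rewrite [iota 2 _](iotaDl 2 0) -map_comp.
  by congr [:: _, _ & _]; apply: etrans (map_nth_iota0 _ (leqnn (size (cargs g)))) _;
    rewrite take_size.
exact: (He (y, (x, g))).
Qed.

Lemma comp_rec (c : ctx) (G : c -> nat) (F : npush (npush c) -> nat) (N : c -> nat) :
  computable G -> computable F -> computable N ->
  computable (fun g => nat_rect (fun=> nat) (G g) (fun x b => F (x, (b, g))) (N g)).
Proof.
move=> [d1 H1] [d2 H2] HN.
apply: (comp_let (F := fun p : npush c =>
  nat_rect (fun=> nat) (G p.2) (fun x b => F (x, (b, p.2))) p.1) HN).
exists (CodeSeq.code [:: 5; d1; d2]) => -[n g] /=; elim: n => [|n IH].
  exact/S5_0/H1.
exact: (S5_S IH (H2 (n, (_, g)))).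
Qed.

Lemma is_fvar0 (c : ctx) : is_fvar (fun p : fpush c => p.1).
Proof. by exists 0 => -[]. Qed.

Lemma is_fvar_wk (c : ctx) (Y : c -> nat -> nat) :
  is_fvar Y -> is_fvar (fun p : npush c => Y p.2).
Proof. by move=> [i Hi]; exists i.+1 => -[x g]; rewrite /= Hi. Qed.

Lemma comp_app (c : ctx) (Y : c -> nat -> nat) (G : c -> nat) :
  is_fvar Y -> computable G -> computable (fun g => Y g (G g)).
Proof.
move=> [i Hi] [d Hd]; exists (CodeSeq.code [:: 8; i; d]) => g.
apply: (S8 (f := @to_partial (tnat ⟶ tnat) (Y g)) (psi := (G g, tt)) (Hi g))
  => // -[|//] _ /= [].
exact: Hd.
Qed.

Lemma comp_suslin (c : ctx) (F : npush c -> nat) :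
  computable F -> computable (fun g => suslin_fun (fun n => F (n, g))).
Proof.
move=> [d Hd]; exists (CodeSeq.code [:: 8; nprefix c + 1; d]) => g.
apply: (S8 (f := @to_partial S2_type suslin_fun)
  (psi := ((fun n => F (n, g)) : ftotal (tnat ⟶ tnat), tt)))=> //;
    first exact: nth_cargs_oracle.
by case=> [|//] _ /= [n []]; apply: (Hd (n, g)).
Qed.

(** The singleton hypothesis keeps the application of [Omega1] defined for every [g], as S8 demands;
    [N] fills its extra number argument. *)
Lemma comp_Omega1 (c : ctx) (F : fpush c -> nat) (x : c -> nat -> nat) (N : c -> nat) :
  computable F -> computable N ->
  (forall g, is_singleton (fun y => F (y, g)) (x g)) ->
  computable (fun g => x g (N g)).
Proof.
move=> [d1 H1] [d2 H2] Fx; exists (CodeSeq.code [:: 8; nprefix c; d1; d2]) => g.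
apply: (S8 (f := (Omega1_fun : fpartial Omega1_type)) (psi :=
  ((fun y => F (y, g)) : ftotal ((tnat ⟶ tnat) ⟶ tnat), ((N g : ftotal tnat), tt)))) => //.
- by rewrite -[nprefix c]addn0 nth_cargs_oracle.
- case=> [|[|//]] _ /=; first by move=> [y []]; exact: (H1 (y, g)).
  by case; exact: (H2 g).
- rewrite /= /Omega1_fun; case: pselect => [h|[]]; last by exists (x g).
  case: cid => z /= Fz; suff -> : z = x g by [].
  have := Fx g z; rewrite Fz asboolT //.
  by case: asboolP.
Qed.

(** * Arithmetical predicates *)

Definition computable_pred (c : ctx) (P : c -> Prop) := computable (fun g => `[< P g >] : nat).

Lemma compP_ext (c : ctx) (P Q : c -> Prop) :
  (forall g, P g <-> Q g) -> computable_pred P -> computable_pred Q.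
Proof. by move=> PQ; apply: comp_ext => g; rewrite (propext (PQ g)). Qed.

Lemma comp_if (c : ctx) (P : c -> Prop) (G H : c -> nat) :
  computable_pred P -> computable G -> computable H ->
    computable (fun g => if `[< P g >] then G g else H g).
Proof.
move=> HP HG HH.
apply: comp_ext (comp_rec HH (comp_wk (comp_wk HG)) HP) => g /=.
by case: `[< _ >].
Qed.

Lemma comp_pred (c : ctx) (G : c -> nat) : computable G -> computable (fun g => (G g).-1).
Proof.
move=> HG; apply: comp_ext (comp_rec (comp_const c 0) (comp_var0 _) HG) => g /=.
by case: (G g).
Qed.

Lemma comp_add (c : ctx) (G H : c -> nat) : computable G -> computable H ->
  computable (fun g => G g + H g).
Proof.
move=> HG HH; apply: comp_ext (comp_rec HG (comp_succ (comp_wk (comp_var0 _))) HH) => g /=.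
by elim: (H g) => [|n /= ->]; rewrite ?addn0 ?addnS.
Qed.

Lemma comp_sub (c : ctx) (G H : c -> nat) : computable G -> computable H ->
  computable (fun g => G g - H g).
Proof.
move=> HG HH; apply: comp_ext (comp_rec HG (comp_pred (comp_wk (comp_var0 _))) HH) => g /=.
by elim: (H g) => [|n /= ->]; rewrite ?subn0 ?subnS.
Qed.

Lemma comp_mul (c : ctx) (G H : c -> nat) : computable G -> computable H ->
  computable (fun g => G g * H g).
Proof.
move=> HG HH.
apply: comp_ext (comp_rec (comp_const c 0)
  (comp_add (comp_wk (comp_wk HG)) (comp_wk (comp_var0 _))) HH) => g /=.
by elim: (H g) => [|n /= ->]; rewrite ?muln0 ?mulnS.
Qed.

Lemma comp_exp (c : ctx) (G H : c -> nat) : computable G -> computable H ->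
  computable (fun g => G g ^ H g).
Proof.
move=> HG HH.
apply: comp_ext (comp_rec (comp_const c 1)
  (comp_mul (comp_wk (comp_wk HG)) (comp_wk (comp_var0 _))) HH) => g /=.
by elim: (H g) => [|n /= ->]; rewrite ?expn0 ?expnS.
Qed.

Lemma comp_double (c : ctx) (G : c -> nat) : computable G -> computable (fun g => (G g).*2).
Proof. by move=> HG; apply: comp_ext (comp_add HG HG) => g; rewrite addnn. Qed.

Lemma compP_eq0 (c : ctx) (G : c -> nat) : computable G -> computable_pred (fun g => G g = 0).
Proof.
move=> HG; apply: comp_ext (comp_sub (comp_const c 1) HG) => g /=.
by rewrite /asbool; case: pselect => /=; case: (G g).
Qed.

Lemma compP_eq (c : ctx) (G H : c -> nat) : computable G -> computable H ->
  computable_pred (fun g => G g = H g).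
Proof.
move=> HG HH; apply: compP_ext (compP_eq0 (comp_add (comp_sub HG HH) (comp_sub HH HG)))
  => g /=.
by lia.
Qed.

Lemma compP_leq (c : ctx) (G H : c -> nat) : computable G -> computable H ->
  computable_pred (fun g => G g <= H g).
Proof.
move=> HG HH; apply: compP_ext (compP_eq0 (comp_sub HG HH)) => g /=.
by lia.
Qed.

Lemma compP_not (c : ctx) (P : c -> Prop) : computable_pred P ->
  computable_pred (fun g => ~ P g).
Proof.
move=> HP; apply: comp_ext (comp_sub (comp_const c 1) HP) => g.
by rewrite asbool_neg; case: `[< _ >].
Qed.

Lemma compP_and (c : ctx) (P Q : c -> Prop) : computable_pred P -> computable_pred Q ->
  computable_pred (fun g => P g /\ Q g).
Proof.
move=> HP HQ; apply: comp_ext (comp_mul HP HQ) => g.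
by rewrite asbool_and; do 2 case: `[< _ >].
Qed.

Lemma compP_imp (c : ctx) (P Q : c -> Prop) : computable_pred P -> computable_pred Q ->
  computable_pred (fun g => P g -> Q g).
Proof.
move=> HP HQ; apply: compP_ext (compP_not (compP_and HP (compP_not HQ))) => g /=.
by split=> [h p|h [p]]; [apply: contrapT => q; apply: h|apply; apply: h].
Qed.

Lemma compP_or (c : ctx) (P Q : c -> Prop) : computable_pred P -> computable_pred Q ->
  computable_pred (fun g => P g \/ Q g).
Proof.
move=> HP HQ; apply: compP_ext (compP_imp (compP_not HP) HQ) => g /=.
by split=> [h|[//|//]]; case: (pselect (P g)) => [|/h]; [left|right].
Qed.

Fixpoint search (P : nat -> Prop) (n : nat) : nat :=
  if n is n'.+1 then
    let b := search P n' in if `[< P b >] then b else b.+1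
  else 0.

(** The candidate grows by one in each round until it satisfies [P], and then stays; so with at
    least [m] rounds the recursion ends at the minimum. *)
Lemma searchE (P : nat -> Prop) n m :
  m <= n -> P m -> (forall i, i < m -> ~ P i) -> search P n = m.
Proof.
move=> le_mn Pm minm.
have below k : k <= m -> search P k = k.
  elim: k => //= k IH lt_km; rewrite IH ?(ltnW lt_km) //.
  by rewrite asboolF //; apply: minm.
elim: n le_mn => [|n IH] /=; first by rewrite leqn0 => /eqP->.
rewrite leq_eqVlt => /orP[/eqP e|/IH->]; last by rewrite asboolT.
rewrite -[LHS]/(search P n.+1) -e.
exact: (below m (leqnn m)).
Qed.

Lemma comp_search (c : ctx) (P : nat -> c -> Prop) (N : c -> nat) :
  computable_pred (fun p : npush c => P p.1 p.2) -> computable N ->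
  computable (fun g => search (P^~ g) (N g)).
Proof.
move=> HP HN.
have H : computable (fun p : npush (npush c) =>
    if `[< P p.2.1 p.2.2 >] then p.2.1 else p.2.1.+1).
  have v := comp_wk (comp_var0 c).
  exact: (comp_if (comp_wk HP) v (comp_succ v)).
apply: comp_ext (comp_rec (comp_const c 0) H HN) => g /=.
by elim: (N g) => //= n ->.
Qed.

(** * Sequence codes *)

(** This is the cons operation of [CodeSeq] on codes, so that pairing also serves for sequences; 0
    codes the empty sequence and every other number is a pair. *)
Definition cpair (a b : nat) : nat := 2 ^ a * b.*2.+1.

Lemma cpairE a b : cpair a b = CodeSeq.code (a :: CodeSeq.decode b).
Proof. by rewrite /= CodeSeq.decodeK. Qed.

Lemma cpair_inj a b a' b' : cpair a b = cpair a' b' -> a = a' /\ b = b'.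
Proof.
rewrite !cpairE => /(can_inj CodeSeq.codeK)[-> /(can_inj CodeSeq.decodeK)->].
by [].
Qed.

Lemma cpair_gt0 a b : 0 < cpair a b.
Proof. by rewrite muln_gt0 expn_gt0. Qed.

Lemma ltn_cpairl a b : a < cpair a b.
Proof. by rewrite /cpair (leq_trans (ltn_expl a (isT : 1 < 2))) ?leq_pmulr. Qed.

Lemma ltn_cpairr a b : b < cpair a b.
Proof. by rewrite /cpair (@leq_trans b.*2.+1) ?leq_pmull ?expn_gt0 //; lia. Qed.

Lemma cpairP s : s = 0 \/ exists a b, s = cpair a b.
Proof.
rewrite -[s]CodeSeq.decodeK; case: (CodeSeq.decode s) => [|a t]; first by left.
by right; exists a, (CodeSeq.code t).
Qed.

Definition chead (s : nat) : nat := head 0 (CodeSeq.decode s).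
Definition ctail (s : nat) : nat := CodeSeq.code (behead (CodeSeq.decode s)).
Definition cnth (s i : nat) : nat := nth 0 (CodeSeq.decode s) i.
Definition csize (s : nat) : nat := size (CodeSeq.decode s).

Lemma chead_cpair a b : chead (cpair a b) = a.
Proof. by rewrite cpairE /chead CodeSeq.codeK. Qed.

Lemma ctail_cpair a b : ctail (cpair a b) = b.
Proof. by rewrite cpairE /ctail CodeSeq.codeK /= CodeSeq.decodeK. Qed.

Lemma comp_cpair (c : ctx) (F G : c -> nat) :
  computable F -> computable G -> computable (fun g => cpair (F g) (G g)).
Proof.
move=> HF HG.
exact: comp_mul (comp_exp (comp_const c 2) HF) (comp_succ (comp_double HG)).
Qed.

Lemma comp_unpair_search (c : ctx) (A S : c -> nat) :
  computable A -> computable S -> computable (fun g => search (fun b => cpair (A g)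
    b = S g) (S g)).
Proof.
move=> HA HS; apply: (comp_search (P := fun b g => cpair (A g) b = S g)) => //.
exact: compP_eq (comp_cpair (comp_wk HA) (comp_var0 c)) (comp_wk HS).
Qed.

Lemma search_cpair a b : search (fun b' => cpair a b' = cpair a b) (cpair a b) = b.
Proof.
apply: searchE (ltnW (ltn_cpairr a b)) _ _ => // i lt_ib /cpair_inj[_ eq_ib].
by rewrite eq_ib ltnn in lt_ib.
Qed.

(** Both components of a pair are below it, so bounded search suffices: the inner search proposes
    the only possible tail for a head [a], and the outer one tests whether it works. *)
Lemma comp_chead (c : ctx) (G : c -> nat) : computable G -> computable (fun g => chead (G g)).
Proof.
move=> HG; pose P a s := cpair a (search (fun b => cpair a b = s) s) = s.
have HP : computable_pred (fun p : npush c => P p.1 (G p.2)).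
  have v := comp_var0 c; have HG' := comp_wk HG.
  exact: compP_eq (comp_cpair v (comp_unpair_search v HG')) HG'.
apply: comp_ext (comp_search (P := fun a g => P a (G g)) HP HG) => g.
have [->//|[a [b ->]]] := cpairP (G g); rewrite chead_cpair.
apply: searchE (ltnW (ltn_cpairl a b)) _ _ => [|i lt_ia]; rewrite /P.
  exact: congr1 (search_cpair a b).
by case/cpair_inj => eq_ia; rewrite eq_ia ltnn in lt_ia.
Qed.

Lemma comp_ctail (c : ctx) (G : c -> nat) : computable G -> computable (fun g => ctail (G g)).
Proof.
move=> HG; apply: comp_ext (comp_unpair_search (comp_chead HG) HG) => g.
have [->//|[a [b ->]]] := cpairP (G g).
by rewrite chead_cpair ctail_cpair; apply: search_cpair.
Qed.

Lemma iter_ctail i s : iter i ctail s = CodeSeq.code (drop i (CodeSeq.decode s)).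
Proof.
elim: i => [|i IH] /=; first by rewrite drop0 CodeSeq.decodeK.
by rewrite IH /ctail CodeSeq.codeK -drop1 drop_drop add1n.
Qed.

Lemma comp_iter_ctail (c : ctx) (I S : c -> nat) :
  computable I -> computable S -> computable (fun g => iter (I g) ctail (S g)).
Proof.
move=> HI HS; have v := comp_ctail (comp_wk (comp_var0 c)).
by apply: comp_ext (comp_rec HS v HI) => g /=; elim: (I g) => //= n ->.
Qed.

Lemma comp_cnth (c : ctx) (S I : c -> nat) :
  computable S -> computable I -> computable (fun g => cnth (S g) (I g)).
Proof.
move=> HS HI; apply: comp_ext (comp_chead (comp_iter_ctail HI HS)) => g /=.
by rewrite iter_ctail /chead CodeSeq.codeK -nth0 nth_drop addn0.
Qed.

Lemma csize_leq s : csize s <= s.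
Proof.
rewrite -{2}[s]CodeSeq.decodeK /csize; elim: (CodeSeq.decode s) => //= a t IH.
by apply: leq_ltn_trans IH (ltn_cpairr a _).
Qed.

Lemma comp_csize (c : ctx) (S : c -> nat) : computable S -> computable (fun g => csize (S g)).
Proof.
move=> HS; have HP : computable_pred (fun p : npush c => iter p.1 ctail (S p.2) = 0).
  exact: compP_eq0 (comp_iter_ctail (comp_var0 c) (comp_wk HS)).
apply: comp_ext (comp_search (P := fun i g => iter i ctail (S g) = 0) HP HS) => g.
have E i : (iter i ctail (S g) = 0) <-> csize (S g) <= i.
  rewrite iter_ctail /csize -subn_eq0 -size_drop.
  case: (drop i _) => // a s; split=> // e.
  by have : 0 < CodeSeq.code (a :: s) := cpair_gt0 a _; rewrite e.
apply: searchE (csize_leq _) _ _ => [|i]; first exact/E.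
by move=> lt_i /E; rewrite leqNgt lt_i.
Qed.

(** * Quantifiers *)

Lemma compP_suslin (c : ctx) (Q : seq nat -> c -> Prop) :
  computable_pred (fun p : npush c => Q (CodeSeq.decode p.1) p.2) ->
  computable_pred (fun g => exists h, forall n, Q (mkseq h n) g).
Proof.
(* The negation adapts truth values to the functional, for which 0 stands for truth. *)
move=> /compP_not/comp_suslin/compP_eq0; apply: compP_ext => g.
rewrite /suslin_fun; case: asboolP => [[h Hh]|H]; split=> //.
  move=> _; exists h => n; have := Hh n; case: asboolP => // H _.
  by apply: contrapT; rewrite CodeSeq.codeK in H.
by case=> h Hh; case: H; exists h => n; rewrite CodeSeq.codeK asboolF // => /(_ (Hh n)).
Qed.

(** A number quantifier is a path quantifier in which only the first entry of the path matters; the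
    empty sequence is left unconstrained. *)
Lemma compP_exists (c : ctx) (P : nat -> c -> Prop) :
  computable_pred (fun p : npush c => P p.1 p.2) -> computable_pred (fun g => exists n, P n g).
Proof.
move=> HP; pose Q s g := s <> [::] -> P (head 0 s) g.
suff /compP_suslin: computable_pred (fun p : npush c => Q (CodeSeq.decode p.1) p.2).
  apply: compP_ext => g; split=> [[h H]|[n Pn]]; first by exists (h 0); apply: (H 1).
  by exists (fun=> n) => m nz; case: m nz.
have v := comp_var0 c.
have HP' : computable_pred (fun p : npush c => P (chead p.1) p.2).
  exact: comp_let (comp_chead v) (comp_swap (comp_wk HP)).
apply: compP_ext (compP_imp (compP_not (compP_eq0 v)) HP') => /= -[s g] /=.
rewrite /Q /chead; split=> H ns; apply: H => e; apply: ns; first by rewrite e.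
by rewrite -[s]CodeSeq.decodeK e.
Qed.

Lemma compP_forall (c : ctx) (P : nat -> c -> Prop) :
  computable_pred (fun p : npush c => P p.1 p.2) -> computable_pred (fun g => forall n, P n g).
Proof.
move=> HP; have HE := compP_exists (P := fun n g => ~ P n g) (compP_not HP).
apply: compP_ext (compP_not HE) => g; split=> [H n|H [n]]; last exact.
by apply: contrapT => Pn; apply: H; exists n.
Qed.

(** * Prewellorders *)

(** The second clause is negative transitivity, which makes incomparability an equivalence. Ties are
    allowed because different terms may name the same position. *)
Definition pwo (T : Type) (lt : T -> T -> Prop) : Prop :=
  well_founded lt /\ forall a b c, lt a b -> lt a c \/ lt c b.

Definition least (T : Type) (lt : T -> T -> Prop) (P : T -> Prop) (a : T) : Prop :=
  P a /\ forall b, lt b a -> ~ P b.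

Section Prewellorders.
Variables (T : Type) (lt : T -> T -> Prop).
Hypothesis lt_pwo : pwo lt.

Lemma pwo_irr a : ~ lt a a.
Proof. by elim/(well_founded_ind lt_pwo.1): a => a IH aa; apply: (IH a). Qed.

Lemma pwo_asym a b : lt a b -> ~ lt b a.
Proof.
elim/(well_founded_ind lt_pwo.1): a b => a IH b ab ba.
exact: (IH b ba a ba ab).
Qed.

Lemma pwo_trans a b c : lt a b -> lt b c -> lt a c.
Proof. by move=> ab /lt_pwo.2-/(_ a)[ba|//]; case: (pwo_asym ab). Qed.

Lemma pwo_le_lt a b c : ~ lt b a -> lt b c -> lt a c.
Proof. by move=> ba /lt_pwo.2-/(_ a)[]. Qed.

Lemma pwo_lt_le a b c : lt a b -> ~ lt c b -> lt a c.
Proof. by move=> /lt_pwo.2-/(_ c)[]. Qed.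

Lemma pwo_least (P : T -> Prop) : (exists a, P a) -> exists a, least lt P a.
Proof.
move=> [a]; elim/(well_founded_ind lt_pwo.1): a => a IH Pa.
case: (pselect (exists2 b, lt b a & P b)) => [[b /IH]|H]; first exact.
by exists a; split=> // b ba Pb; apply: H; exists b.
Qed.

Lemma pwo_image (S : Type) (f : S -> T) : pwo (fun a b => lt (f a) (f b)).
Proof.
split=> [a|a b c]; last exact: lt_pwo.2.
suff acc y : forall b, f b = y -> Acc (fun a b => lt (f a) (f b)) b by apply: (acc (f a)).
elim/(well_founded_ind lt_pwo.1): y => y IH b yE; constructor=> b' lt_b'b.
by apply: (IH (f b')) => //; rewrite -yE.
Qed.

End Prewellorders.

(** A non-accessible element has a non-accessible predecessor, and choice iterates this to a chain.
    The chain form is the one that [suslin_fun] can test. *)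
Lemma well_founded_no_chain (T : Type) (lt : T -> T -> Prop) :
  well_founded lt <-> ~ exists h : nat -> T, forall i, lt (h i.+1) (h i).
Proof.
split=> [wf [h hP]|H a].
  suff chain a : forall i, h i <> a by exact: (chain (h 0) 0).
  elim/(well_founded_ind wf): a => a IH i ia; apply: (IH (h i.+1) _ i.+1) => //.
  by rewrite -ia.
apply: contrapT => Na; apply: H.
have next (x : {x | ~ Acc lt x}) : {y : {x | ~ Acc lt x} | lt (sval y) (sval x)}.
  apply: cid; case: x => x Nx /=; apply: contrapT => H; apply: Nx.
  by constructor=> y yx; apply: contrapT => Ny; apply: H; exists (exist _ y Ny).
pose h i := iter i (fun x => sval (next x)) (exist _ a Na).
by exists (fun i => sval (h i)) => i; apply: (svalP (next (h i))).
Qed.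

Lemma wf_recursion (T C : Type) (lt : T -> T -> Prop) (F : T -> (T -> C) -> C) :
  inhabited C -> well_founded lt ->
  (forall a r r', (forall b, lt b a -> r b = r' b) -> F a r = F a r') ->
  exists r, forall a, r a = F a r.
Proof.
move=> [c0] wf Fext.
pose G a (rec : forall b, lt b a -> C) :=
  F a (fun b => if pselect (lt b a) is left h then rec b h else c0).
exists (Fix wf (fun=> C) G) => a; rewrite Fix_eq => [|x f g fg]; last first.
  by apply: Fext => b ba; case: pselect.
by apply: Fext => b ba; case: pselect.
Qed.

(** * Comparing ranks *)

(* [sim a b] says that a and b have the same rank. *)
Inductive sim (T1 T2 : Type) (lt1 : T1 -> T1 -> Prop) (lt2 : T2 -> T2 -> Prop)
    (a : T1) (b : T2) : Prop :=
  Sim of (forall a', lt1 a' a -> exists2 b', lt2 b' b & sim lt1 lt2 a' b')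
       & (forall b', lt2 b' b -> exists2 a', lt1 a' a & sim lt1 lt2 a' b').

Lemma sim_sym (T1 T2 : Type) (lt1 : T1 -> T1 -> Prop) (lt2 : T2 -> T2 -> Prop) a b :
  well_founded lt1 -> sim lt1 lt2 a b -> sim lt2 lt1 b a.
Proof.
move=> wf; elim/(well_founded_ind wf): a b => a IH b [ab ba].
split=> [b' /ba|a' aa']; first by move=> [a' aa' /IH]; exists a'; auto.
by have [b' bb' /IH] := ab _ aa'; exists b'; auto.
Qed.

Lemma sim_trans (T1 T2 T3 : Type) (lt1 : T1 -> T1 -> Prop)
    (lt2 : T2 -> T2 -> Prop) (lt3 : T3 -> T3 -> Prop) a b c :
  well_founded lt1 -> sim lt1 lt2 a b -> sim lt2 lt3 b c -> sim lt1 lt3 a c.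
Proof.
move=> wf; elim/(well_founded_ind wf): a b c => a IH b c [ab ba] [bc cb].
split=> [a' aa'|c' /cb[b' /ba[a' aa' sa sb]]]; last by exists a' => //; exact: IH sa sb.
have [b' /bc[c' cc' sb] sa] := ab _ aa'.
by exists c' => //; apply: IH sa sb.
Qed.

Lemma sim_not_lt (T : Type) (lt : T -> T -> Prop) a b :
  well_founded lt -> sim lt lt a b -> ~ lt a b.
Proof.
move=> wf; elim/(well_founded_ind wf): a b => a IH b [_ ba] ab.
have [a' a'a s] := ba _ ab; exact: (IH a' a'a a s a'a).
Qed.

Lemma eqv_sim (T : Type) (lt : T -> T -> Prop) a b :
  pwo lt -> ~ lt a b -> ~ lt b a -> sim lt lt a b.
Proof.
move=> lt_pwo.
have refl x : sim lt lt x x.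
  by elim/(well_founded_ind lt_pwo.1): x => x IH; split=> y yx; exists y; auto.
by move=> ab ba; split=> c ca; exists c => //; apply: (pwo_lt_le lt_pwo) ca _.
Qed.

Section Comparison.
Variables (T1 T2 : Type) (lt1 : T1 -> T1 -> Prop) (lt2 : T2 -> T2 -> Prop).
Hypotheses (pwo1 : pwo lt1) (pwo2 : pwo lt2).

Lemma sim_lt a b a' b' : sim lt1 lt2 a b -> sim lt1 lt2 a' b' -> lt1 a a' -> lt2 b b'.
Proof.
move=> ab [H _] /H[b0 b0b' ab0]; apply: (pwo_le_lt pwo2) b0b' => b0b.
apply: sim_not_lt b0b; first exact: pwo2.1.
exact: sim_trans pwo2.1 (sim_sym pwo1.1 ab0) ab.
Qed.

(** Double induction. If some [a'] below [a] has no match below [b], the induction hypothesis for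
    [a'] and [b] matches [b] with [a'] or with something below it; symmetrically for some [b'] below
    [b]. *)
Lemma sim_trichotomy a b :
  [\/ sim lt1 lt2 a b, exists2 a', lt1 a' a & sim lt1 lt2 a' b
    | exists2 b', lt2 b' b & sim lt1 lt2 a b'].
Proof.
elim/(well_founded_ind pwo1.1): a b => a IHa; elim/(well_founded_ind pwo2.1) => b IHb.
case: (pselect (forall a', lt1 a' a -> exists2 b', lt2 b' b & sim lt1 lt2 a' b')) => [Ha|].
  case: (pselect (forall b', lt2 b' b -> exists2 a', lt1 a' a & sim lt1 lt2 a' b')) => [Hb|].
    by apply: Or31; split.
  move=> /existsNP[b' /not_implyP[b'b H]]; have [s|//|[b'' b''b' s]] := IHb _ b'b.
    by apply: Or33; exists b'.
  by apply: Or33; exists b'' => //; apply: (pwo_trans pwo2) b'b.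
move=> /existsNP[a' /not_implyP[a'a H]]; have [s|[a'' a''a' s]|//] := IHa _ a'a b.
  by apply: Or32; exists a'.
by apply: Or32; exists a'' => //; apply: (pwo_trans pwo1) a'a.
Qed.

End Comparison.

(** * Transfinite runs *)

Definition conf := nat -> nat.

Section Positions.
Variables (T : Type) (lt : T -> T -> Prop).

Definition zero (a : T) : Prop := forall b, ~ lt b a.
Definition succ (a b : T) : Prop := lt a b /\ forall c, ~ (lt a c /\ lt c b).
Definition limit (l : T) : Prop := ~ zero l /\ forall a, ~ succ a l.

Lemma position_cases a : [\/ zero a, exists a', succ a' a | limit a].
Proof.
case: (pselect (zero a)) => [|nz]; first by apply: Or31.
case: (pselect (exists a', succ a' a)) => [|ns]; first by apply: Or32.
by apply: Or33; split=> // a' sa'; apply: ns; exists a'.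
Qed.

Definition cofinal (r : T -> conf) (l : T) (k : nat) : Prop :=
  forall b, lt b l -> exists c, [/\ lt b c, lt c l & r c k <> 0].

(* The entries of a configuration are the state, the position of the head and
   the cells, with cell i of tape j < 3 at index 3 i + j + 2; the limit state
   is 1. *)
Definition limit_conf (r : T -> conf) (l : T) : conf :=
  fun k => match k with 0 => 1 | 1 => 0 | _ => `[< cofinal r l k >] : nat end.

Definition run (c0 : conf) (st : conf -> conf) (r : T -> conf) : Prop :=
  [/\ forall a, zero a -> forall k, r a k = c0 k,
      forall a b, succ a b -> forall k, r b k = st (r a) k &
      forall l, limit l -> forall k, r l k = limit_conf r l k].

(* From b on, the configurations between b and a repeat forever. *)
Definition loop (r : T -> conf) (b a : T) : Prop :=
  [/\ lt b a, limit b, forall k, r b k = r a k &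
      forall c k, ~ lt c b -> lt c a -> r b k.+2 = 0 -> r c k.+2 = 0].

Definition ended (r : T -> conf) (a : T) : Prop := r a 0 = 2 \/ exists b, loop r b a.

End Positions.

Section SimPositions.
Variables (T1 T2 : Type) (lt1 : T1 -> T1 -> Prop) (lt2 : T2 -> T2 -> Prop).
Hypotheses (pwo1 : pwo lt1) (pwo2 : pwo lt2).

Lemma sim_zero a b : sim lt1 lt2 a b -> zero lt1 a -> zero lt2 b.
Proof. by move=> [_ ba] za b' /ba[a' /za]. Qed.

Lemma sim_succ a b a' : sim lt1 lt2 a b -> succ lt1 a' a ->
  exists2 b', succ lt2 b' b & sim lt1 lt2 a' b'.
Proof.
move=> ab [a'a nb]; have [H1 H2] := ab.
have [b' b'b a'b'] := H1 _ a'a; exists b' => //; split=> // c [b'c cb].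
have [a'' a''a s] := H2 _ cb; apply: (nb a''); split=> //.
exact: (sim_lt pwo2 pwo1 (sim_sym pwo1.1 a'b') (sim_sym pwo1.1 s) b'c).
Qed.

End SimPositions.

Section SimRuns.
Variables (T1 T2 : Type) (lt1 : T1 -> T1 -> Prop) (lt2 : T2 -> T2 -> Prop).
Hypotheses (pwo1 : pwo lt1) (pwo2 : pwo lt2).
Variables (c0 : conf) (st : conf -> conf) (r1 : T1 -> conf) (r2 : T2 -> conf).
Hypotheses (run1 : run lt1 c0 st r1) (run2 : run lt2 c0 st r2).

Lemma sim_limit a b : sim lt1 lt2 a b -> limit lt1 a -> limit lt2 b.
Proof.
move=> /(sim_sym pwo1.1) ba [nz ns]; split=> [zb|b' sb'].
  exact/nz/(sim_zero ba zb).
by have [a' /ns] := sim_succ pwo2 pwo1 ba sb'.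
Qed.

(** Determinism, by induction on rank. At a limit, the matches below [a] and [b] carry cofinality of
    a cell back and forth. *)
Lemma run_sim a b : sim lt1 lt2 a b -> r1 a = r2 b.
Proof.
elim/(well_founded_ind pwo1.1): a b => a IH b ab; apply: funext => k.
have [z1 s1 l1] := run1; have [z2 s2 l2] := run2.
have [za|[a' sa]|la] := position_cases lt1 a.
- by rewrite z1 // z2 //; exact: (sim_zero ab za).
- have [b' sb a'b'] := sim_succ pwo1 pwo2 ab sa.
  by rewrite (s1 _ _ sa) (s2 _ _ sb) (IH a' _ b') //; case: sa.
rewrite l1 // l2 //; last exact: (sim_limit ab la).
case: k => [|[|k]] //=; congr (nat_of_bool _); apply: asbool_equiv_eq.
have [H1 H2] := ab; split=> cof x xl.
  have [a' a'a s] := H2 _ xl; have [c [a'c ca rc]] := cof _ a'a.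
  have [d db s'] := H1 _ ca; exists d; split=> //; first exact: (sim_lt pwo1 pwo2 s s' a'c).
  by rewrite -(IH c).
have [b' b'b s] := H1 _ xl; have [c [b'c cb rc]] := cof _ b'b.
have [d da s'] := H2 _ cb; exists d; split=> //; last by rewrite (IH d da c).
exact: (sim_lt pwo2 pwo1 (sim_sym pwo1.1 s) (sim_sym pwo1.1 s') b'c).
Qed.

Lemma sim_loop a b a' b' : sim lt1 lt2 a a' -> sim lt1 lt2 b b' ->
  loop lt1 r1 b a -> loop lt2 r2 b' a'.
Proof.
move=> sa sb [ba lb eq_ba st0]; split.
- exact: (sim_lt pwo1 pwo2 sb sa ba).
- exact: (sim_limit sb lb).
- by move=> k; rewrite -(run_sim sa) -(run_sim sb).
move=> c k cb' ca'; have [_ /(_ c ca')[d da s]] := sa.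
rewrite -(run_sim s) -(run_sim sb); apply: st0 => // db; apply: cb'.
exact: (sim_lt pwo1 pwo2 s sb db).
Qed.

Lemma sim_ended a a' : sim lt1 lt2 a a' -> ended lt1 r1 a -> ended lt2 r2 a'.
Proof.
move=> sa [h|[b lb]]; [left|right]; first by rewrite -(run_sim sa).
have [ba _ _ _] := lb; have [/(_ b ba)[b' _ sb] _] := sa.
by exists b'; exact: (sim_loop sa sb lb).
Qed.

End SimRuns.

(** * Loops never halt *)

Lemma not_zero (T : Type) (lt : T -> T -> Prop) (a : T) : ~ zero lt a -> exists b, lt b a.
Proof. by move=> nz; apply: contrapT => H; apply: nz => b ba; apply: H; exists b. Qed.

Section Tails.
Variables (T : Type) (lt : T -> T -> Prop).
Hypothesis lt_pwo : pwo lt.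
Variables (c0 : conf) (st : conf -> conf) (r : T -> conf).
Hypothesis r_run : run lt c0 st r.

Lemma run_eqv a b : ~ lt a b -> ~ lt b a -> r a = r b.
Proof. by move=> ab ba; exact: (run_sim lt_pwo lt_pwo r_run r_run (eqv_sim lt_pwo ab ba)). Qed.

Variable b : T.

Definition tail := {x : T | ~ lt x b}.
Definition tail_lt (x y : tail) := lt (sval x) (sval y).

Lemma tail_pwo : pwo tail_lt.
Proof. exact: pwo_image. Qed.

Lemma tail_up (x : tail) (y : T) : lt (sval x) y -> ~ lt y b.
Proof. by move=> xy yb; apply: (svalP x); apply: (pwo_trans lt_pwo) xy yb. Qed.

Lemma tail_succ (x y : tail) : succ tail_lt x y -> succ lt (sval x) (sval y).
Proof.
move=> [xy nc]; split=> // c [xc cy].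
exact: (nc (exist _ c (tail_up xc))).
Qed.

Lemma tail_limit (x : tail) : limit tail_lt x -> limit lt (sval x).
Proof.
move=> [nz ns].
have [y yx] := not_zero nz.
split=> [zx|a [ax nc]]; first exact: (zx (sval y)).
have ab : ~ lt a b.
  move=> ab; apply: (nc (sval y)); split=> //.
  exact: (pwo_lt_le lt_pwo ab (svalP y)).
by apply: (ns (exist _ a ab)); split=> // c; apply: nc.
Qed.

(** The tail starts at [b] up to ties, and tied positions have the same configuration. A limit of
    the tail has a tail element below it, so its cells are governed by the tail alone. *)
Lemma tail_run c1 : (forall k, r b k = c1 k) -> run tail_lt c1 st (fun x => r (sval x)).
Proof.
move=> bc1; have [rz rs rl] := r_run; split=> [x zx k|x y /tail_succ sxy k|x lx k].
- rewrite -bc1 (_ : r (sval x) = r b) //; apply: run_eqv (svalP x) _ => bx.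
  exact: (zx (exist _ b (pwo_irr lt_pwo (a := b)))).
- exact: rs.
rewrite rl; last exact: tail_limit.
case: k => [|[|k]] //=; congr (nat_of_bool _); apply: asbool_equiv_eq.
split=> cof y yx.
  have [c [yc cx rc]] := cof _ yx.
  by exists (exist _ c (tail_up yc)).
case: (pselect (lt y b)) => [yb|ny].
  have [nz _] := lx.
  have [z zx] := not_zero nz.
  have [c [zc cx rc]] := cof _ zx.
  exists (sval c); split=> //; apply: (pwo_lt_le lt_pwo yb (svalP c)).
have [c [yc cx rc]] := cof (exist _ y ny) yx.
by exists (sval c).
Qed.

End Tails.

Lemma min_upper_bound (T : Type) (lt : T -> T -> Prop) (S : T -> Prop) (h : T) :
  pwo lt -> (forall x, S x -> lt x h) ->
  exists u, [/\ ~ lt h u, forall x, S x -> lt x u &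
    forall y, lt y u -> exists2 x, S x & ~ lt x y].
Proof.
move=> lt_pwo Sh.
have [|u [Su minu]] := pwo_least lt_pwo (P := fun u => forall x, S x -> lt x u).
  by exists h.
exists u; split=> // [/minu|y /minu/existsNP[x /not_implyP[Sx xy]]]; first exact.
by exists x.
Qed.

(** Suppose nothing halts before [h]. Call [x] a repeat if it looks like [b] and no cell that is 0
    at [b] comes on in between, and let [u] be the least strict upper bound of the repeats below
    [h]. At a successor [u] there is a last repeat, from which the run copies the stretch from [b]
    to [a] and so reaches another one; a limit [u] is itself a repeat. *)
Lemma loop_halt (T : Type) (lt : T -> T -> Prop) c0 st (r : T -> conf) a b h :
  pwo lt -> run lt c0 st r -> loop lt r b a -> lt a h -> r h 0 = 2 ->
  exists2 x, lt x h & r x 0 = 2.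
Proof.
move=> lt_pwo r_run [ba lb r_ba st0] ah halt_h; apply: contrapT => first_h.
have {}first_h x : lt x h -> r x 0 <> 2 by move=> xh rx; apply: first_h; exists x.
have [rz rs rl] := r_run.
pose B x := [/\ ~ lt x b, forall k, r b k = r x k &
  forall c k, ~ lt c b -> lt c x -> r b k.+2 = 0 -> r c k.+2 = 0].
pose S x := B x /\ lt x h.
have Sa : S a by split=> //; split=> //; apply: (pwo_asym lt_pwo).
have [u [hu Su minu]] : exists u, [/\ ~ lt h u, forall x, S x -> lt x u &
    forall y, lt y u -> exists2 x, S x & ~ lt x y].
  by apply: min_upper_bound => // x [].
have au := Su _ Sa; have bu := pwo_trans lt_pwo ba au.
have st0u c k : ~ lt c b -> lt c u -> r b k.+2 = 0 -> r c k.+2 = 0.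
  move=> cb /minu[x [[xb rx x0] xh] xc] b0.
  case: (pselect (lt c x)) => [cx|cx]; first exact: x0.
  by rewrite (run_eqv lt_pwo r_run cx xc) -rx.
have [zu|[p [pu pn]]|lu] := position_cases lt u; first exact: zu bu.
  have [x Sx xp] := minu _ pu.
  have [[xb rx x0] xh] := Sx; have xu := Su _ Sx.
  have px : ~ lt p x by move=> px; apply: (pn x).
  have xmax y : S y -> ~ lt x y.
    by move=> /Su yu xy; apply: (pn y); split=> //; apply: (pwo_le_lt lt_pwo xp xy).
  have U1 : run (@tail_lt T lt b) (r b) st (fun z : tail lt b => r (sval z)).
    exact: (tail_run lt_pwo r_run).
  have U2 : run (@tail_lt T lt x) (r b) st (fun z : tail lt x => r (sval z)).
    by apply: (tail_run lt_pwo r_run) => k; rewrite rx.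
  have P1 := tail_pwo lt_pwo b; have P2 := tail_pwo lt_pwo x.
  pose a' : tail lt b := exist _ a (pwo_asym lt_pwo ba).
  pose h' : tail lt x := exist _ h (pwo_asym lt_pwo xh).
  have simr z z' (s : sim (@tail_lt T lt b) (@tail_lt T lt x) z z') : r (sval z) = r (sval z').
    exact: (run_sim P1 P2 U1 U2 s).
  (* Compare the stretch from [b] to [a] with the one from [x] to [h]. If the latter is not longer,
     [h] copies a position at or before [a], which would halt before [h]; otherwise the copy [d] of
     [a] is a repeat after [x]. *)
  have [s|[z za s]|[d dh s]] := sim_trichotomy P1 P2 a' h'.
  - by apply: (first_h a) => //; rewrite (simr _ _ s).
  - by apply: (first_h (sval z)); [exact: (pwo_trans lt_pwo za ah)|rewrite (simr _ _ s)].
  have xd : lt x (sval d).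
    have [/(_ (exist _ b (pwo_irr lt_pwo (a := b))) ba)[b' b'd _] _] := s.
    exact: (pwo_le_lt lt_pwo (svalP b') b'd).
  apply: (xmax (sval d) _ xd); split; last exact: dh.
  split; first by move=> db; apply: xb; apply: (pwo_trans lt_pwo xd db).
    by move=> k; rewrite -(simr _ _ s) r_ba.
  move=> c k cb cd b0; case: (pselect (lt c x)) => [cx|cx]; first exact: x0.
  have [_ /(_ (exist _ c cx) cd)[z za s']] := s.
  have /= <- := simr _ _ s'; exact: (st0 _ k (svalP z) za b0).
(* At a limit [u], cells off at [b] stay off up to [u], and cells on at [b] are on at the repeats,
   which are cofinal in [u]. *)
have ru k : r b k = r u k.
  rewrite (rl u) //; case: k => [|[|k]]; [by rewrite rl|by rewrite rl|].
  case: (eqVneq (r b k.+2) 0) => [b0|/eqP b1] /=.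
    rewrite asboolF // => /(_ _ bu)[c [bc cu]]; apply; apply: st0u b0 => //.
    exact: pwo_asym.
  rewrite asboolT => [|y yu].
    by move: b1; rewrite rl //=; case: asboolP.
  have [y' [yy' y'u]] : exists y', lt y y' /\ lt y' u.
    have [_ /(_ y) ns] := lu; apply: contrapT => H; apply: ns; split=> // c [yc cu].
    by apply: H; exists c.
  have [x Sx xy'] := minu _ y'u; have [[_ rx _] _] := Sx; exists x; split.
  - exact: (pwo_lt_le lt_pwo yy' xy').
  - exact: Su.
  - by rewrite -rx.
have Bu : B u by split=> //; apply: (pwo_asym lt_pwo).
(* If [u] is below [h], it is a repeat above all repeats; if it ties with [h], the limit state 1
   clashes with the halt state 2. *)
case: (pselect (lt u h)) => [uh|uh]; first exact: (pwo_irr lt_pwo (Su u (conj Bu uh))).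
by have := halt_h; rewrite -(run_eqv lt_pwo r_run uh hu) rl.
Qed.

(** * A well-order in which countable sequences are bounded *)

Section Below.
Variables (W : Type) (R : rel W).
Hypothesis R_wo : well_order R.

Let least_of (P : W -> Prop) : (exists x, P x) ->
  exists z, [/\ P z, forall y, P y -> R z y &
    forall z', P z' -> (forall y, P y -> R z' y) -> z' = z].
Proof.
move=> [x Px]; pose A : {pred W} := fun y => `[< P y >].
have [|z [[Az lbz] uniqz]] := R_wo (A := A); first by exists x; apply/asboolP.
exists z; split; [exact/asboolP|by move=> y Py; apply/lbz/asboolP|].
move=> z' Pz' lbz'; symmetry; apply: uniqz; split; first exact/asboolP.
by move=> y /asboolP; apply: lbz'.
Qed.

Lemma wo_refl x : R x x.
Proof. by have [z [<- lbz _]] := @least_of (eq x) (ex_intro _ x erefl); apply: lbz. Qed.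

Lemma wo_antisym x y : R x y -> R y x -> x = y.
Proof.
move=> xy yx; have [|z [_ _ uniqz]] := @least_of (fun z => z = x \/ z = y).
  by exists x; left.
have xz : x = z.
  by apply: uniqz => [|_ [->|->] //]; [left|apply: wo_refl].
have yz : y = z.
  by apply: uniqz => [|_ [->|->] //]; [right|apply: wo_refl].
by rewrite xz yz.
Qed.

Lemma below_pwo : pwo (below R).
Proof.
split=> [a|a b c].
  apply: contrapT => Na.
  have [|z [Nz lbz _]] := @least_of (fun x => ~ Acc (below R) x); first by exists a.
  apply: Nz; constructor=> y yz; apply: contrapT => /lbz zy.
  by rewrite /below zy in yz.
move=> ab; rewrite /below.
case: (boolP (R c a)) => [ca|]; last by left.
case: (boolP (R b c)) => [bc|]; last by right.
have [|z [Pz lbz _]] := @least_of (fun z => [\/ z = a, z = b | z = c]);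
  first by exists a; apply: Or31.
have Rza := lbz a (Or31 _ _ erefl); have Rzb := lbz b (Or32 _ _ erefl).
have Rzc := lbz c (Or33 _ _ erefl).
move: ab; case/negP; case: Pz => zE; rewrite zE in Rza Rzb Rzc => //.
  by rewrite (wo_antisym Rzc ca).
by rewrite -(wo_antisym Rzb bc).
Qed.

End Below.

Section LongWellOrder.
Variables (T : Type) (R : rel T).
Hypothesis R_wo : well_order R.
Hypothesis T_uncountable : forall f : nat -> T, exists b, forall n, f n <> b.

Definition enumerable (P : T -> Prop) : Prop :=
  exists f : nat -> T, forall x, P x -> exists n, f n = x.

(** The elements with countably many predecessors form an initial segment of order type omega_1. *)
Definition short (x : T) : Prop := enumerable (fun y => below R y x).

(** An enumeration would make the least non-short element short or, if all elements are short,
    enumerate [T]. *)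
Lemma not_enumerable_short : ~ enumerable short.
Proof.
move=> short_enum; have [f fP] := short_enum; have lt_pwo := below_pwo R_wo.
case: (pselect (exists x, ~ short x)) => [/(pwo_least lt_pwo)[a [Na mina]]|H].
  apply: Na; exists f => x xa; apply: fP.
  by apply: contrapT; apply: mina.
have [b fb] := T_uncountable f.
by have [|n /fb//] := fP b; apply: contrapT => Nb; apply: H; exists b.
Qed.

Definition long := {x : T | short x}.
Definition long_le (x y : long) : bool := R (sval x) (sval y).

Lemma long_wo : well_order long_le.
Proof.
move=> A [x Ax].
pose A' : {pred T} := fun y => `[< exists2 z, z \in A & sval z = y >].
have [|y [[/asboolP[z Az <-] lbz] _]] := R_wo (A := A').
  by exists (sval x); apply/asboolP; exists x.
have lbz' : lower_bound long_le A z.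
  by move=> z' Az'; apply: lbz; apply/asboolP; exists z'.
exists z; split=> [//|z' [Az' lb']]; apply: eq_sig_hprop => [? ? ?|];
  first exact: Prop_irrelevance.
exact: (wo_antisym R_wo (lbz' _ Az') (lb' _ Az)).
Qed.

(** Otherwise every short element lies at or below some [f n], and the union of these countably many
    countable segments would be enumerable. *)
Lemma long_bounded (f : nat -> long) : exists b, forall n, below long_le (f n) b.
Proof.
have lt_pwo := below_pwo R_wo.
apply: contrapT => H; apply: not_enumerable_short.
have [g gP] := choice (P := fun n (g : nat -> T) =>
  forall x, below R x (sval (f n)) -> exists m, g m = x) (fun n => svalP (f n)).
(* Tail 0 names [f n] itself, tail [m.+1] the [m]-th entry of the list of its predecessors. *)
exists (fun s => if ctail s is m.+1 then g (chead s) m else sval (f (chead s))) => x Sx.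
have [n] : exists n, ~ below R (sval (f n)) x.
  by apply: contrapT => H'; apply: H; exists (exist _ x Sx) => n; apply: contrapT => nb;
    apply: H'; exists n.
move=> nx; case: (pselect (below R x (sval (f n)))) => [/gP[m <-]|xn].
  by exists (cpair n m.+1); rewrite ctail_cpair chead_cpair.
exists (cpair n 0); rewrite ctail_cpair chead_cpair.
by apply: (wo_antisym R_wo); [move: xn|move: nx]; rewrite /below => /negP; rewrite negbK.
Qed.

Lemma long_inhabited : inhabited T -> inhabited long.
Proof.
move=> [x0]; apply: contrapT => H; apply: not_enumerable_short.
by exists (fun=> x0) => x Sx; case: H; constructor; exists x.
Qed.

End LongWellOrder.

Lemma exists_bounded_well_order : exists (W : Type) (R : rel W),
  [/\ well_order R, inhabited W & forall f : nat -> W, exists b, forall n, below R (f n) b].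
Proof.
have [R R_wo] := well_ordering_principle (nat -> bool : eqType).
have uncountable (f : nat -> nat -> bool) : exists b, forall n, f n <> b.
  exists (fun n => ~~ f n n) => n /(congr1 (@^~ n)) /=.
  by case: (f n n).
exists (long R), (@long_le _ R); split.
- exact: long_wo.
- exact: (long_inhabited R_wo uncountable (inhabits xpred0)).
- exact: long_bounded.
Qed.

(** * Existence of a loop in a long run *)

Section LoopExists.
Variables (W : Type) (lt : W -> W -> Prop).
Hypotheses (lt_pwo : pwo lt) (w0 : W).
Hypothesis bounded : forall f : nat -> W, exists b, forall n, lt (f n) b.
Variables (c0 : conf) (st : conf -> conf) (r : W -> conf).
Hypothesis r_run : run lt c0 st r.

Let stable k := exists a, forall b, lt a b -> r b k = 0.

(** Each step of [next] passes a nonzero value of every non-stable cell; [l] is the least strict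
    upper bound of the omega iterates from [a]. *)
Let exists_cofinal_limit a :
  exists l, [/\ lt a l, limit lt l & forall k, ~ stable k -> cofinal lt r l k].
Proof.
have next_ex b : exists b', lt b b' /\
    forall k, ~ stable k -> exists c, [/\ lt b c, lt c b' & r c k <> 0].
  have /choice[h hP] k : exists c, ~ stable k -> lt b c /\ r c k <> 0.
    case: (pselect (stable k)) => [|ns]; first by exists w0.
    apply: contrapT => H; apply: ns; exists b => c bc; apply: contrapT => rc.
    by apply: H; exists c.
  have [b' b'P] := bounded (fun n => if n is k.+1 then h k else b).
  exists b'; split=> [|k /hP[bh rh]]; first exact: (b'P 0).
  by exists (h k); split=> //; apply: (b'P k.+1).
have [next nextP] := choice next_ex.
have [u uP] := bounded (fun n => iter n next a).
have [l [_ lP minl]] : exists l, [/\ ~ lt u l,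
    forall x, (exists n, x = iter n next a) -> lt x l &
    forall y, lt y l -> exists2 x, (exists n, x = iter n next a) & ~ lt x y].
  by apply: min_upper_bound => // _ [n ->].
have {}minl y : lt y l -> exists n, ~ lt (iter n next a) y.
  by move=> /minl[_ [n ->]]; exists n.
have {}lP n : lt (iter n next a) l by apply: lP; exists n.
exists l; split; first exact: (lP 0).
  split=> [zl|y [yl ny]]; first exact: (zl _ (lP 0)).
  have [n yn] := minl _ yl; apply: (ny (iter n.+1 next a)); split=> //.
  by apply: (pwo_le_lt lt_pwo yn); apply: (nextP _).1.
move=> k ns y yl; have [n yn] := minl _ yl.
have [c [nc cn rc]] := (nextP (iter n next a)).2 k ns.
exists c; split=> //; first exact: (pwo_le_lt lt_pwo yn).
exact: (pwo_trans lt_pwo cn (lP n.+1)).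
Qed.

(** Past a common bound [d] of the stabilisation points, all limits at which every non-stable cell
    is cofinally on have the same configuration: a cell is 1 there iff it is not stable. Two such
    limits form a loop, since a cell that is 0 at the first is stable. *)
Lemma exists_loop : exists b a, loop lt r b a.
Proof.
have /choice[s sP] k : exists a, stable k -> forall b, lt a b -> r b k = 0.
  by case: (pselect (stable k)) => [[a aP]|]; [exists a|exists w0].
have [d dP] := bounded s.
have stab0 k b : stable k -> ~ lt b d -> r b k = 0.
  by move=> /sP H bd; apply: H; apply: (pwo_lt_le lt_pwo (dP k) bd).
have [b [db lb cb]] := exists_cofinal_limit d.
have [a [ba la ca]] := exists_cofinal_limit b.
have [_ _ rl] := r_run; have da := pwo_trans lt_pwo db ba.
exists b, a; split=> // [k|c k cb' _ b0].
  rewrite !rl //; case: k => [|[|k]] //=; congr (nat_of_bool _).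
  case: (pselect (stable k.+2)) => [sk|nsk]; last by rewrite !asboolT; auto.
  have noncof x : lt d x -> ~ cofinal lt r x k.+2.
    by move=> dx /(_ _ dx)[c [dc cx]]; apply; apply: stab0 => //; apply: (pwo_asym lt_pwo).
  by rewrite !asboolF; auto.
apply: stab0; last by move=> cd; apply: cb'; apply: (pwo_trans lt_pwo cd db).
apply: contrapT => nsk; move: b0; rewrite rl //= asboolT //; exact: cb.
Qed.

End LoopExists.

(** * Certificates *)

(* The dummy cell 0 is always on, so that clauses 3 and 4 of [phi] also yield
   successors and predecessors. *)
Definition on (c : conf) (k : nat) : Prop := k = 0 \/ c k.+1 <> 0.

Section Terms.
Variables (T : Type) (lt : T -> T -> Prop) (r : T -> conf) (top : T).

(* A term (j, s, t, k) denotes the least d with [phi j s t k d].  Closure under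
   clauses 3 and 4 makes quantification over the positions below a limit
   absolute; clause 1 provides the start of the loop that ends at top. *)
Definition phi (j : nat) (s t : T) (k : nat) (d : T) : Prop :=
  [\/ j = 1 /\ loop lt r d top,
      j = 2,
      j = 3 /\ [/\ lt s d, lt d t & on (r d) k] |
      j = 4 /\ lt d t /\ forall c, lt d c -> lt c t -> ~ on (r c) k].

(** A term without a witness denotes [top], up to ties, so that every term has a value. *)
Definition denotes (j : nat) (s t : T) (k : nat) (u : T) : Prop :=
  (exists d, phi j s t k d) /\ least lt (phi j s t k) u \/
  [/\ forall d, ~ phi j s t k d, ~ lt u top & ~ lt top u].

End Terms.

(** Every number [u] is read as the term with entries [cnth u 0] to [cnth u 3]. The number 0 codes
    the empty sequence, so its [j] is 0, no clause of [phi] applies, and it names the top. *)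
Definition certificate (c0 : conf) (st : conf -> conf)
    (lt : nat -> nat -> Prop) (r : nat -> conf) : Prop :=
  [/\ pwo lt, run lt c0 st r, forall u, ~ lt 0 u,
      least lt (ended lt r) 0 &
      forall u, denotes lt r 0 (cnth u 0) (cnth u 1) (cnth u 2) (cnth u 3) u].

Lemma denotes_ex (T : Type) (lt : T -> T -> Prop) (r : T -> conf) top j s t k :
  pwo lt -> exists u, denotes lt r top j s t k u.
Proof.
move=> lt_pwo; case: (pselect (exists d, phi lt r top j s t k d)) => [H|H].
  by have [u lu] := pwo_least lt_pwo H; exists u; left.
exists top; right; split; try exact: pwo_irr.
by move=> d Hd; apply: H; exists d.
Qed.

Lemma cnth_lt u i : 0 < u -> cnth u i < u.
Proof.
move=> u_gt0; rewrite /cnth; case: (ltnP i (size (CodeSeq.decode u))) => [lt_i|?].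
  exact: (all_nthP 0 (CodeSeq.gtn_decode u)).
by rewrite nth_default.
Qed.

Definition code4 (j s t k : nat) : nat := CodeSeq.code [:: j; s; t; k].

Lemma cnth_code4 j s t k :
  [/\ cnth (code4 j s t k) 0 = j, cnth (code4 j s t k) 1 = s,
      cnth (code4 j s t k) 2 = t & cnth (code4 j s t k) 3 = k].
Proof. by rewrite /cnth CodeSeq.codeK. Qed.

Lemma sim_total (T1 T2 : Type) (lt1 : T1 -> T1 -> Prop) (lt2 : T2 -> T2 -> Prop) top1 top2 x :
  pwo lt1 -> (forall u, ~ lt1 top1 u) -> sim lt1 lt2 top1 top2 ->
  exists y, sim lt1 lt2 x y.
Proof.
move=> pwo1 max1 s; case: (pselect (lt1 x top1)) => [xt|tx].
  by have [/(_ x xt)[y _ sy] _] := s; exists y.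
by exists top2; apply: (sim_trans pwo1.1 (eqv_sim pwo1 _ _) s).
Qed.

Section PhiSim.
Variables (T1 T2 : Type) (lt1 : T1 -> T1 -> Prop) (lt2 : T2 -> T2 -> Prop).
Hypotheses (pwo1 : pwo lt1) (pwo2 : pwo lt2).
Variables (c0 : conf) (st : conf -> conf) (r1 : T1 -> conf) (r2 : T2 -> conf).
Hypotheses (run1 : run lt1 c0 st r1) (run2 : run lt2 c0 st r2).
Variables (top1 : T1) (top2 : T2).
Hypothesis sim_top : sim lt1 lt2 top1 top2.

Lemma phi_sim j k s t d s' t' d' :
  sim lt1 lt2 s s' -> sim lt1 lt2 t t' -> sim lt1 lt2 d d' ->
  phi lt1 r1 top1 j s t k d -> phi lt2 r2 top2 j s' t' k d'.
Proof.
move=> ss tt dd [[-> l]|->|[-> [sd dt od]]|[-> [dt od]]].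
- by apply: Or41; split=> //; apply: (sim_loop pwo1 pwo2 run1 run2 sim_top dd l).
- exact: Or42.
- apply: Or43; split=> //; split.
  + exact: (sim_lt pwo1 pwo2 ss dd sd).
  + exact: (sim_lt pwo1 pwo2 dd tt dt).
  + by rewrite -(run_sim pwo1 pwo2 run1 run2 dd).
apply: Or44; split=> //; split; first exact: (sim_lt pwo1 pwo2 dd tt dt).
move=> c' dc' ct'; have [_ /(_ c' ct')[c ct cc]] := tt.
rewrite -(run_sim pwo1 pwo2 run1 run2 cc); apply: od => //.
exact: (sim_lt pwo2 pwo1 (sim_sym pwo1.1 dd) (sim_sym pwo1.1 cc) dc').
Qed.

End PhiSim.

Section DenotesSim.
Variables (T1 T2 : Type) (lt1 : T1 -> T1 -> Prop) (lt2 : T2 -> T2 -> Prop).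
Hypotheses (pwo1 : pwo lt1) (pwo2 : pwo lt2).
Variables (c0 : conf) (st : conf -> conf) (r1 : T1 -> conf) (r2 : T2 -> conf).
Hypotheses (run1 : run lt1 c0 st r1) (run2 : run lt2 c0 st r2).
Variables (top1 : T1) (top2 : T2).
Hypotheses (max1 : forall u, ~ lt1 top1 u) (max2 : forall u, ~ lt2 top2 u).
Hypothesis sim_top : sim lt1 lt2 top1 top2.

(** Similarity of the tops gives every position on one side a match on the other, so least witnesses
    correspond, and so do default values. *)
Lemma denotes_sim j k s t u s' t' u' :
  sim lt1 lt2 s s' -> sim lt1 lt2 t t' ->
  denotes lt1 r1 top1 j s t k u -> denotes lt2 r2 top2 j s' t' k u' ->
  sim lt1 lt2 u u'.
Proof.
move=> ss tt.
have sim_top' := sim_sym pwo1.1 sim_top.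
have ss' := sim_sym pwo1.1 ss; have tt' := sim_sym pwo1.1 tt.
have fwd := phi_sim pwo1 pwo2 run1 run2 sim_top (j := j) (k := k) ss tt.
have bwd := phi_sim pwo2 pwo1 run2 run1 sim_top' (j := j) (k := k) ss' tt'.
have tot1 x := sim_total x pwo1 max1 sim_top.
have tot2 x := sim_total x pwo2 max2 sim_top'.
move=> [[ex1 [phiu minu]]|[nex1 ut tu]] [[ex2 [phiu' minu']]|[nex2 ut' tu']].
- have [y uy] := tot1 u; have [x u'x] := tot2 u'.
  apply: (sim_trans pwo1.1 uy (eqv_sim pwo2 _ _)) => [yu'|u'y].
    exact: (minu' y yu' (fwd _ _ uy phiu)).
  have xu := sim_lt pwo2 pwo1 u'x (sim_sym pwo1.1 uy) u'y.
  exact: (minu x xu (bwd _ _ u'x phiu')).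
- by have [d /[dup] phid] := ex1; have [y dy] := tot1 d; case: (nex2 y (fwd _ _ dy phid)).
- by have [d /[dup] phid] := ex2; have [y dy] := tot2 d; case: (nex1 y (bwd _ _ dy phid)).
apply: (sim_trans pwo1.1 (eqv_sim pwo1 ut tu)).
exact: (sim_trans pwo1.1 sim_top (eqv_sim pwo2 tu' ut')).
Qed.

End DenotesSim.

(** * Uniqueness of certificates *)

Section CertificateUnique.
Variables (c0 : conf) (st : conf -> conf).
Variables (lt1 lt2 : nat -> nat -> Prop) (r1 r2 : nat -> conf).
Hypotheses (cert1 : certificate c0 st lt1 r1) (cert2 : certificate c0 st lt2 r2).

(** The tops are similar because both are first ended positions of runs with the same data.
    Induction on codes does the rest, since the subterms of a nonzero code are smaller. *)
Lemma certificate_sim u : sim lt1 lt2 u u.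
Proof.
have [pwo1 run1 max1 [end1 first1] den1] := cert1.
have [pwo2 run2 max2 [end2 first2] den2] := cert2.
have sim_top : sim lt1 lt2 0 0.
  have [//|[a a0 /(sim_sym pwo1.1) s]|[a a0 s]] := sim_trichotomy pwo1 pwo2 0 0.
    by case: (first1 a a0); apply: (sim_ended pwo2 pwo1 run2 run1 s).
  by case: (first2 a a0); apply: (sim_ended pwo1 pwo2 run1 run2 s).
elim/ltn_ind: u => -[|u] IH //.
apply: (denotes_sim pwo1 pwo2 run1 run2 max1 max2 sim_top _ _ (den1 _) (den2 _)).
  exact/IH/cnth_lt.
exact/IH/cnth_lt.
Qed.

Lemma certificate_unique : lt1 = lt2 /\ r1 = r2.
Proof.
have [pwo1 run1 _ _ _] := cert1; have [pwo2 run2 _ _ _] := cert2.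
split; apply: funext => s; last exact: (run_sim pwo1 pwo2 run1 run2 (certificate_sim s)).
apply: funext => t; apply: propext; split.
  exact: (sim_lt pwo1 pwo2 (certificate_sim s) (certificate_sim t)).
apply: (sim_lt pwo2 pwo1); exact: sim_sym pwo1.1 (certificate_sim _).
Qed.

End CertificateUnique.

(** * Existence of certificates *)

Section CertificateExists.
Variables (T : Type) (lt : T -> T -> Prop).
Hypothesis lt_pwo : pwo lt.
Variables (c0 : conf) (st : conf -> conf) (r : T -> conf).
Hypothesis r_run : run lt c0 st r.
Variable top : T.
Hypothesis first_end : least lt (ended lt r) top.

Lemma valuation_exists : exists val : nat -> T, val 0 = top /\
  forall u, denotes lt r top (cnth u 0) (val (cnth u 1)) (val (cnth u 2)) (cnth u 3) (val u).
Proof.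
pose den j s t k := cid (denotes_ex r top j s t k lt_pwo).
pose F u (v : nat -> T) := if u is 0 then top else
  sval (den (cnth u 0) (v (cnth u 1)) (v (cnth u 2)) (cnth u 3)).
have [|||val valE] := @wf_recursion nat T (fun a b => a < b) F.
- exact: (inhabits top).
- by move=> u; elim/ltn_ind: u => u IH; constructor.
- by case=> // u v v' vv'; rewrite /F !(vv' (cnth u.+1 _)) // cnth_lt.
exists val; split=> [|u]; first by rewrite valE.
case: u => [|u]; last by rewrite [X in denotes _ _ _ _ _ _ _ X]valE;
  apply: (svalP (den _ _ _ _)).
right; split; try by rewrite valE; apply: pwo_irr.
by move=> d [[]|//|[]|[]].
Qed.

Variable val : nat -> T.
Hypothesis val0 : val 0 = top.
Hypothesis valP : forall u,
  denotes lt r top (cnth u 0) (val (cnth u 1)) (val (cnth u 2)) (cnth u 3) (val u).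

Let ltN (s t : nat) : Prop := lt (val s) (val t).
Let rN (s : nat) : conf := r (val s).
Let ltN_pwo : pwo ltN := pwo_image lt_pwo val.

Let denoted j s t k : exists u, denotes lt r top j (val s) (val t) k (val u).
Proof.
exists (code4 j s t k); have := valP (code4 j s t k).
by have [-> -> -> ->] := cnth_code4 j s t k.
Qed.

(** Clauses 1, 3 and 4 yield positions below [top] or below the value of a subterm, and clause 2
    holds of [top] itself, so its least witness is not above. *)
Let val_top u : ~ lt top (val u).
Proof.
elim/ltn_ind: u => -[_|u IH]; first by rewrite val0; apply: pwo_irr.
have IHt := IH _ (cnth_lt 2 (ltn0Sn u)).
have below_t d : lt d (val (cnth u.+1 2)) -> ~ lt top d.
  by move=> dt td; apply: IHt; apply: (pwo_trans lt_pwo td dt).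
have [[_ [phiu minu]]|[_]] := valP u.+1; last by [].
case: phiu minu => [[_ [ut _ _ _]] _|j2 minu|[_ [_ ut _]] _|[_ [ut _]] _]; try exact: below_t.
  exact: (pwo_asym lt_pwo).
by move/minu; apply; apply: Or42.
Qed.

(** Clauses 3 and 4 act as Skolem functions: here and in [off_from], a witness in [T] is replaced by
    one that a term names. *)
Let on_between s t k d : lt (val s) d -> lt d (val t) -> on (r d) k ->
  exists u, [/\ ltN s u, ltN u t & on (rN u) k].
Proof.
move=> sd dt od; have [u [[_ [phiu _]]|[nex _ _]]] := denoted 3 s t k.
  by case: phiu => [[]|//|[_ [? ? ?]]|[]] //; exists u.
by case: (nex d); apply: Or43.
Qed.

Let off_from t k d : lt d (val t) -> (forall c, lt d c -> lt c (val t) -> ~ on (r c) k) ->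
  exists u, ltN u t /\ forall c, lt (val u) c -> lt c (val t) -> ~ on (r c) k.
Proof.
move=> dt od; have [u [[_ [phiu _]]|[nex _ _]]] := denoted 4 0 t k.
  by case: phiu => [[]|//|[]|[_ [? ?]]] //; exists u.
by case: (nex d); apply: Or44.
Qed.

Let val_zero a : zero ltN a <-> zero lt (val a).
Proof.
split=> [za b ba|za b]; last exact: za.
have [u [[_ [_ minu]]|[nex _ _]]] := denoted 2 0 0 0; last by case: (nex top); apply: Or42.
apply: (za u); apply: (pwo_le_lt lt_pwo _ ba) => /minu; apply; exact: Or42.
Qed.

Let on0 c : on c 0. Proof. by left. Qed.

Let val_succ a b : succ ltN a b <-> succ lt (val a) (val b).
Proof.
split=> [[ab nab]|[ab nab]]; split=> // c; last exact: nab.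
by move=> [ac cb]; have [u [au ub _]] := on_between ac cb (on0 _); apply: (nab u).
Qed.

Let val_limit l : limit ltN l <-> limit lt (val l).
Proof.
split=> [[nz ns]|[nz ns]]; split.
- by move/val_zero.
(* If [val l] had a predecessor [d], clause 4 for the dummy cell would name a position with nothing
   between it and [val l]. *)
- move=> d [dl nd]; have [|u [ul nu]] := off_from (k := 0) dl.
    by move=> c dc cl _; apply: (nd c).
  by apply: (ns u); split=> // c [uc cl]; apply: (nu (val c) uc cl (on0 _)).
- by move/val_zero.
- by move=> a /val_succ; apply: ns.
Qed.

Let on_cell c k : on c k.+1 <-> c k.+2 <> 0.
Proof. by split=> [[]|] //; right. Qed.

Let val_run : run ltN c0 st rN.
Proof.
have [rz rs rl] := r_run; split=> [a /val_zero/rz//|a b /val_succ/rs//|l ll k].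
rewrite /rN rl; last exact/val_limit.
case: k => [|[|k]] //=; congr (nat_of_bool _); apply: asbool_equiv_eq; split=> cof.
  move=> b /cof[c [bc cl rc]].
  have [u [bu ul /on_cell]] := on_between bc cl ((on_cell _ _).2 rc).
  by exists u.
(* If the cell were off after [b], clause 4 would name such a point, contradicting cofinality among
   the terms. *)
move=> b bl; apply: contrapT => H.
have [|u [ul nu]] := off_from (k := k.+1) bl.
  by move=> c bc cl /on_cell rc; apply: H; exists c.
have [c [uc cl rc]] := cof u ul.
exact: (nu (val c) uc cl ((on_cell _ _).2 rc)).
Qed.

Let val_loop u : loop ltN rN u 0 <-> loop lt r (val u) top.
Proof.
split=> [[u0 lu eq_u st0]|[u0 lu eq_u st0]]; split.
- by rewrite -val0.
- exact/val_limit.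
- by rewrite -val0.
- move=> c k cu ct ru; case: (pselect (lt (val u) c)) => [uc|uc]; last first.
    by rewrite -(run_eqv lt_pwo r_run uc cu).
  apply: contrapT => rc; rewrite -val0 in ct.
  have [v [uv v0 /on_cell]] := on_between uc ct ((on_cell _ _).2 rc); apply.
  by apply: st0 => //; apply: (pwo_asym ltN_pwo).
- by rewrite /ltN val0.
- exact/val_limit.
- by rewrite /rN val0.
- by rewrite /ltN val0 => c k; apply: st0.
Qed.

Let val_phi j s t k d : phi ltN rN 0 j s t k d <-> phi lt r top j (val s) (val t) k (val d).
Proof.
split=> [[[-> /val_loop]|->|H|[-> [dt od]]]|[[-> /val_loop]|->|H|[-> [dt od]]]];
  try by [move=> l; apply: Or41|apply: Or42|apply: Or43].
  apply: Or44; split=> //; split=> // c dc ct oc.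
  by have [u [du ut ou]] := on_between dc ct oc; apply: (od u).
by apply: Or44; split=> //; split=> // c; apply: od.
Qed.

Let val_denotes u : denotes ltN rN 0 (cnth u 0) (cnth u 1) (cnth u 2) (cnth u 3) u.
Proof.
have [[_ [phiu minu]]|[nex ut tu]] := valP u; [left|right].
  split; first by exists u; apply/val_phi.
  by split=> [|d du /val_phi]; [apply/val_phi|apply: minu].
by split=> [d /val_phi||]; [apply: nex|rewrite /ltN val0|rewrite /ltN val0].
Qed.

(* Ranks can only decrease in a suborder. *)
Let val_rank u w : sim ltN lt u w -> ~ lt (val u) w.
Proof.
elim/(well_founded_ind ltN_pwo.1): u w => u IH w [_ wu] uw.
have [u' u'u s] := wu _ uw; exact: (IH u' u'u _ s u'u).
Qed.

(** The values need not form an initial segment, but by [val_rank] the top does not gain rank in the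
    suborder. Were its rank smaller, the restricted run would match the original one up to a
    position below [top], which would be ended, against minimality. *)
Lemma valuation_certificate : certificate c0 st ltN rN /\ sim ltN lt 0 top.
Proof.
have [end_top first_top] := first_end.
have ended0 : ended ltN rN 0.
  case: end_top => [h|[d ld]]; [by left; rewrite /rN val0|right].
  have [u [[_ [phiu _]]|[nex _ _]]] := denoted 1 0 0 0.
    by case: phiu => [[_ /val_loop]|//|[]|[]] //; exists u.
  by case: (nex d); apply: Or41.
have sim_top : sim ltN lt 0 top.
  have [//|[u u0 s]|[w wt s]] := sim_trichotomy ltN_pwo lt_pwo 0 top.
    by case: (val_rank s); rewrite -val0.
  by case: (first_top w wt); apply: (sim_ended ltN_pwo lt_pwo val_run r_run s).
split=> //; split=> //; first by move=> u; rewrite /ltN val0; apply: val_top.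
split=> // u u0 endu; have [/(_ u u0)[w wt s] _] := sim_top.
by apply: (first_top w wt); apply: (sim_ended ltN_pwo lt_pwo val_run r_run s).
Qed.

End CertificateExists.

(** * Machine codes *)

Lemma nth_allpairs (S T U : Type) (f : S -> T -> U) x0 y0 z0 s t i j :
  i < size s -> j < size t ->
  nth z0 [seq f x y | x <- s, y <- t] (i * size t + j) = f (nth x0 s i) (nth y0 t j).
Proof.
elim: s i => //= x s IH [|i] lt_i lt_j; rewrite nth_cat size_map.
  by rewrite mul0n add0n lt_j (nth_map y0).
by rewrite mulSn -addnA ltnNge leq_addr addKn IH.
Qed.

Definition symbol_index (x : symbol) : nat := let: (a, b, c) := x in 4 * a + 2 * b + c.

Lemma ltn_symbol_index x : symbol_index x < 8.
Proof. by case: x => [[[] []] []]. Qed.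

Lemma nth_symbols x0 x : nth x0 symbols (symbol_index x) = x.
Proof. by case: x => [[[] []] []]. Qed.

Lemma symbol_index_nth x0 m : m < 8 -> symbol_index (nth x0 symbols m) = m.
Proof. by do 8 case: m => [//|m]. Qed.

Lemma decode_ittm_code (M : ittm) :
  CodeSeq.decode (ittm_code M) = nst M ::
    [seq transition_code (delta q x) | q <- enum 'I_(nst M).+3, x <- symbols].
Proof. by rewrite /ittm_code CodeSeq.codeK. Qed.

Lemma cnth_ittm_code (M : ittm) (q : 'I_(nst M).+3) (x : symbol) :
  cnth (ittm_code M) (1 + q * 8 + symbol_index x) = transition_code (delta q x).
Proof.
rewrite /cnth decode_ittm_code add1n addSn /=.
have := nth_allpairs (fun q x => transition_code (delta q x)) q x 0
  (s := enum 'I_(nst M).+3) (t := symbols) (i := q) (j := symbol_index x).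
by rewrite size_enum_ord nth_ord_enum nth_symbols => ->; rewrite ?ltn_ord ?ltn_symbol_index.
Qed.

(** An arithmetical description of the machine codes: eight transitions per state behind the leading
    entry, each with a state, three written bits and a move. It lets the halting problem reject
    numbers that code no machine. *)
Definition valid (e : nat) : Prop :=
  csize e = ((cnth e 0).+3 * 8).+1 /\
  forall i, i < (cnth e 0).+3 * 8 ->
    csize (cnth e i.+1) = 5 /\ cnth (cnth e i.+1) 0 < (cnth e 0).+3 /\
    forall j, j < 4 -> cnth (cnth e i.+1) j.+1 < 2.

Lemma valid_ittm_code (M : ittm) : valid (ittm_code M).
Proof.
have c0 : cnth (ittm_code M) 0 = nst M by rewrite /cnth decode_ittm_code.
split.
  rewrite /csize decode_ittm_code c0; congr _.+1.
  by apply: etrans (size_allpairs _ _ _) _; rewrite size_enum_ord.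
rewrite c0 => i lt_i; rewrite -[i.+1]add1n {1 2 3}(divn_eq i 8) addnA.
have lt_q : i %/ 8 < (nst M).+3 by rewrite ltn_divLR.
have x0 : symbol := (false, false, false).
rewrite -[i %/ 8]/(val (Ordinal lt_q)) -(@symbol_index_nth x0 (i %% 8)) ?ltn_mod //.
rewrite cnth_ittm_code; case: delta => [[q [[a b] c]] d].
rewrite /csize /cnth CodeSeq.codeK; split=> //; split; first exact: ltn_ord.
by case=> [|[|[|[|//]]]] _ /=; rewrite ltnS leq_b1.
Qed.

Lemma validP (e : nat) : valid e -> exists M, ittm_code M = e.
Proof.
move=> [size_e e_ok]; set n := cnth e 0 in size_e e_ok.
pose tr (q : 'I_n.+3) x := cnth e (1 + q * 8 + symbol_index x).
pose d (q : 'I_n.+3) x := (inord (cnth (tr q x) 0) : 'I_n.+3,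
  (cnth (tr q x) 1 != 0, cnth (tr q x) 2 != 0, cnth (tr q x) 3 != 0),
  cnth (tr q x) 4 != 0).
have trE q x : transition_code (d q x) = tr q x.
  have lt_i : q * 8 + symbol_index x < n.+3 * 8.
    have := ltn_ord q; have := ltn_symbol_index x; lia.
  have := e_ok _ lt_i; rewrite -[(_ + _).+1]add1n addnA -/(tr q x) => -[size_tr [q_ok b_ok]].
  rewrite -[RHS]CodeSeq.decodeK -[LHS]/(CodeSeq.code [:: _; _; _; _; _]).
  congr CodeSeq.code; rewrite /= inordK //.
  have bE i : i < 4 -> (cnth (tr q x) i.+1 != 0) = cnth (tr q x) i.+1 :> nat.
    by move/b_ok; case: (cnth _ _) => [|[]].
  rewrite !bE //; move: size_tr; rewrite /csize /cnth.
  by case: (CodeSeq.decode _) => [|? [|? [|? [|? [|? [|]]]]]].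
pose l := [seq transition_code (d q x) | q <- enum 'I_n.+3, x <- symbols].
have size_l : size l = n.+3 * 8.
  by apply: etrans (size_allpairs _ _ _) _; rewrite size_enum_ord.
exists (@Ittm n d); rewrite -[RHS]CodeSeq.decodeK; congr CodeSeq.code.
change (n :: l = CodeSeq.decode e).
apply: (@eq_from_nth _ 0) => [|[//|i]] /=; rewrite size_l; first exact/esym/size_e.
rewrite ltnS => lt_i.
have lt_q : i %/ 8 < n.+3 by rewrite ltn_divLR.
have x0 : symbol := (false, false, false).
rewrite [in LHS](divn_eq i 8).
apply: etrans (nth_allpairs _ ord0 x0 _ _ _) _; rewrite ?size_enum_ord ?ltn_mod //.
rewrite trE /tr nth_enum_ord // symbol_index_nth ?ltn_mod // add1n addSn -divn_eq.
by [].
Qed.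

(** * Machine runs as abstract runs *)

Definition tape_cell (M : ittm) (c : config M) (k : nat) : bool :=
  match k %% 3 with
  | 0 => input c (k %/ 3)
  | 1 => scratch c (k %/ 3)
  | _ => output c (k %/ 3)
  end.

Definition enc (M : ittm) (c : config M) : conf := fun k =>
  match k with 0 => state c | 1 => pos c | k.+2 => tape_cell c k end.

Definition init_conf (n : nat) : conf := fun k => `[< exists i, i < n /\ k = i * 3 + 2 >].

(** [p] is the index of the input cell under the head, followed by its scratch and output cells. [t]
    is looked up behind the leading entry [nst], in the block of eight symbols of the current
    state. *)
Definition step_conf (e : nat) (c : conf) : conf := fun k =>
  let p := c 1 * 3 + 2 in
  let t := cnth e (1 + c 0 * 8 + (4 * c p + 2 * c p.+1 + c p.+2)) in
  if `[< k = 0 >] then cnth t 0 else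
  if `[< k = 1 >] then if `[< cnth t 4 = 0 >] then (c 1).-1 else (c 1).+1 else
  if `[< k = p >] then cnth t 1 else
  if `[< k = p.+1 >] then cnth t 2 else
  if `[< k = p.+2 >] then cnth t 3 else c k.

Lemma tape_cellE (M : ittm) (c : config M) i j : j < 3 ->
  tape_cell c (i * 3 + j) = match j with 0 => input c i | 1 => scratch c i | _ => output
    c i end.
Proof.
by move=> lt_j; rewrite /tape_cell modnMDl modn_small // divnMDl // divn_small // addn0.
Qed.

Lemma enc_initial (M : ittm) n : enc (initial M n) = init_conf n.
Proof.
apply: funext => k; rewrite /init_conf; case: k => [|[|k]].
- rewrite /= inordK // asboolF // => -[i [_]]; lia.
- rewrite /= asboolF // => -[i [_]]; lia.
rewrite /= (divn_eq k 3); have := ltn_pmod k (isT : 0 < 3).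
move: (k %/ 3) (k %% 3) => i j lt_j; rewrite tape_cellE //; congr nat_of_bool.
apply/idP/asboolP => [|[i' [lt_i' eq_i]]].
  by case: j lt_j => [|[]//] _; rewrite /= /numeral => lt_in; exists i; split=> //; lia.
by rewrite (_ : j = 0) /= /numeral; lia.
Qed.

Lemma enc_step (M : ittm) (c : config M) : enc (step c) = step_conf (ittm_code M) (enc c).
Proof.
apply: funext => k; rewrite /step_conf.
set p := enc c 1 * 3 + 2.
have pE : p = (pos c * 3).+2 by rewrite /p addn2.
have -> : enc c p = input c (pos c) by rewrite pE /= -[_ * 3]addn0 tape_cellE.
have -> : enc c p.+1 = scratch c (pos c) by rewrite pE /= -addn1 tape_cellE.
have -> : enc c p.+2 = output c (pos c) by rewrite pE /= -addn2 tape_cellE.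
have := cnth_ittm_code (state c) (input c (pos c), scratch c (pos c), output c (pos c)).
rewrite /step /symbol_index /= => ->.
case: delta => [[q [[a b] d]] mv]; rewrite /cnth CodeSeq.codeK /=.
case: k => [|[|k]]; first by rewrite asboolT.
  rewrite asboolF // asboolT //=.
  by case: mv; [rewrite asboolF|rewrite asboolT].
rewrite asboolF // asboolF // pE; set E := enc c k.+2.
have EE : E = tape_cell c k by []; rewrite {}EE.
rewrite (divn_eq k 3); have := ltn_pmod k (isT : 0 < 3).
move: (k %/ 3) (k %% 3) => i j lt_j; rewrite /= !tape_cellE //= /write.
case: (eqVneq i (pos c)) => [->|ne_i].
  case: j lt_j => [|[|[|//]]] _.
  - by rewrite asboolT // addn0.
  - by rewrite asboolF ?asboolT //; lia.
  - by rewrite asboolF; last lia; rewrite asboolF; last lia; rewrite asboolT; last lia.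
do 3 (rewrite asboolF; last by move: ne_i => /eqP; lia).
by case: j lt_j => [|[|[]]].
Qed.

Lemma enc_run (M : ittm) n (W : Type) (R : rel W) (r : W -> config M) :
  is_run R n r ->
  run (below R) (init_conf n) (step_conf (ittm_code M)) (fun a => enc (r a)).
Proof.
move=> [rz rs rl]; split=> [a za k|a b sab k|l ll k].
- by rewrite rz // enc_initial.
- by rewrite (rs a b) // enc_step.
rewrite (rl l) //; case: k => [|[|k]] //=; first by rewrite inordK.
rewrite /tape_cell /=; congr nat_of_bool.
have E (f : config M -> nat -> bool) :
    (forall c, tape_cell c k = f c (k %/ 3)) ->
    limit_tape R l (fun a => f (r a)) (k %/ 3) = `[< cofinal (below R)
      (fun a => enc (r a)) l k.+2 >].
  move=> fE; apply: asbool_equiv_eq; split=> cof b bl; have [c [bc cl cc]] := cof b bl;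
    exists c; split=> //.
    by rewrite /= fE cc.
  by move: cc; rewrite /= fE; case: (f _ _).
move: E; rewrite /tape_cell; case: (k %% 3) => [|[|j]] E; exact: E.
Qed.

Lemma run_exists (M : ittm) n (W : Type) (R : rel W) :
  well_order R -> exists r, is_run (M := M) R n r.
Proof.
move=> R_wo; have lt_pwo := below_pwo R_wo.
pose F (a : W) (r : W -> config M) : config M :=
  if pselect (is_zero R a) then initial M n else
  if pselect (exists a', is_succ R a' a) is left h then step (r (projT1 (cid h))) else
  Config (limit_state M) 0 (limit_tape R a (fun a => input (r a)))
    (limit_tape R a (fun a => scratch (r a))) (limit_tape R a (fun a => output (r a))).
have [|||r rE] := @wf_recursion W (config M) (below R) F.
- exact: (inhabits (initial M n)).
- exact: lt_pwo.1.
- move=> a r r' rr'; rewrite /F; case: (pselect (is_zero R a)) => //= _;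
  case: pselect => [h|_].
    by case: (cid h) => a' [a'a na] /=; rewrite rr'.
  have E (f : config M -> nat -> bool) :
      limit_tape R a (fun b => f (r b)) = limit_tape R a (fun b => f (r' b)).
    apply: funext => i; apply: asbool_equiv_eq; split=> cof b ba;
      have [c [bc ca cc]] := cof b ba; exists c; split=> //.
      by rewrite -rr'.
    by rewrite rr'.
  by rewrite (E (@input M)) (E (@scratch M)) (E (@output M)).
exists r; split=> [a za|a b sab|l [nz ns]]; rewrite rE /F.
- by case: pselect.
- case: pselect => [zb|_] /=; first by case: (zb a); case: sab.
  case: pselect => [h|[]]; last by exists a.
  case: cid => a' [a'b na'] /=; have [ab na] := sab; suff -> : a' = a by [].
  by apply: (wo_antisym R_wo); apply: contrapT => /negP H; [apply: (na a')|apply: (na' a)].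
case: pselect => //= _; case: pselect => // -[a sa]; by case: (ns a).
Qed.

Definition ittm_certificate (e n : nat) : (nat -> nat -> Prop) -> (nat -> conf) -> Prop :=
  certificate (init_conf n) (step_conf e).

(** On a well-order with bounded countable sequences the run has a loop, hence an ended position,
    and the first one serves as top. If its state is 2, it is the first halting position, because a
    halted position is ended. *)
Lemma certificate_exists (M : ittm) n :
  exists lt r, ittm_certificate (ittm_code M) n lt r /\ (r 0 0 = 2 -> halts M n).
Proof.
have [W [R [R_wo [w0] bounded]]] := exists_bounded_well_order.
have [r r_run] := run_exists M n R_wo.
have lt_pwo := below_pwo R_wo; have er := enc_run r_run.
have [b [a lba]] := exists_loop lt_pwo w0 bounded er.
have [|top first_end] := pwo_least lt_pwo (P := ended (below R) (fun a => enc (r a))).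
  by exists a; right; exists b.
have [val [val0 valP]] := valuation_exists lt_pwo (fun a => enc (r a)) top.
have [cert s] := valuation_certificate lt_pwo er first_end val0 valP.
do 2 eexists; split; first exact: cert.
rewrite /= val0 => halt_top; exists (output (r top)), W, R, r, top; split=> //.
  move=> x /first_end.2 Nx hx; apply: Nx; left.
  by rewrite /= hx /halt_state inordK.
by apply: val_inj; rewrite /= halt_top /halt_state inordK.
Qed.

(** Compare the top with [h]. If [h] matches a position before the top, that position is ended too
    early. If the top matches some [a] before [h], then [a] halts too early or closes a loop, which
    [loop_halt] excludes. Index [i * 3 + 4] is output cell [i]. *)
Lemma certificate_halts (M : ittm) n lt r T :
  ittm_certificate (ittm_code M) n lt r -> halts_with M n T ->
  r 0 0 = 2 /\ forall i, r 0 (i * 3 + 4) = T i.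
Proof.
move=> [lt_pwo r_run max0 [end0 first0] _] [W [R [r' [h [R_wo r'_run first_h halt_h out_h]]]]].
have pwo' := below_pwo R_wo; have er := enc_run r'_run.
have enc_h : enc (r' h) 0 = 2 by rewrite /= halt_h /halt_state inordK.
have not_halted x : below R x h -> enc (r' x) 0 <> 2.
  move=> /first_h Nx /= hx; apply: Nx; apply: val_inj.
  by rewrite /= hx /halt_state inordK.
have [s|[u u0 s]|[a ah s]] := sim_trichotomy lt_pwo pwo' 0 h.
- have -> := run_sim lt_pwo pwo' r_run er s; split=> // i.
  by rewrite addnS /= addn3 -addn2 /= tape_cellE // out_h.
- case: (first0 u u0); left; by rewrite (run_sim lt_pwo pwo' r_run er s).
have [h0|[b lb]] := sim_ended lt_pwo pwo' r_run er s end0; first by case: (not_halted a).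
by have [x xh hx] := loop_halt pwo' er lb ah enc_h; case: (not_halted x).
Qed.

(** * Computability of certificates *)

(** One function stores both parts of a certificate: even second components hold the relation, odd
    ones the configurations. *)
Definition code_lt (y : nat -> nat) (s t : nat) : Prop := y (cpair s t.*2) <> 0.
Definition code_conf (y : nat -> nat) (s : nat) : conf := fun k => y (cpair s k.*2.+1).

(** The value at 0, which is no pair, and the range of the relation entries are fixed so that a
    certificate has exactly one code. *)
Definition code_of_certificate (e n : nat) (y : nat -> nat) : Prop :=
  [/\ y 0 = 0, forall s t, y (cpair s t.*2) <= 1 &
      ittm_certificate e n (code_lt y) (code_conf y)].

Lemma code_of_certificate_unique e n y y' :
  code_of_certificate e n y -> code_of_certificate e n y' -> y = y'.
Proof.
move=> [y0 y1 cert] [y'0 y'1 cert']; have [lt_eq conf_eq] := certificate_unique cert cert'.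
apply: funext => z; have [->|[s [m ->]]] := cpairP z; first by rewrite y0 y'0.
rewrite -[m]odd_double_half; case: (odd m); rewrite /= ?add1n ?add0n.
  by have := congr1 (fun r : nat -> conf => r s m./2) conf_eq.
have := congr1 (fun lt : nat -> nat -> Prop => lt s m./2) lt_eq; rewrite /code_lt.
have := y1 s m./2; have := y'1 s m./2.
by case: (y _) => [|[]] //; case: (y' _) => [|[]] // _ _ E; exfalso;
  move: E => /propeqP[H1 H2]; [case: (H2 _)|case: (H1 _)].
Qed.

Lemma code_of_certificate_exists e n lt r :
  ittm_certificate e n lt r -> exists y, code_of_certificate e n y /\ code_conf y = r.
Proof.
pose y z := if z == 0 then 0 else
  if odd (ctail z) then r (chead z) (ctail z)./2 else `[< lt (chead z) (ctail z)./2 >] : nat.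
have yE s m : y (cpair s m) = if odd m then r s m./2 else `[< lt s m./2 >].
  by rewrite /y gtn_eqF ?cpair_gt0 // chead_cpair ctail_cpair.
have lt_eq : code_lt y = lt.
  apply: funext => s; apply: funext => t; apply: propext.
  by rewrite /code_lt yE odd_double doubleK; case: asboolP; split.
have conf_eq : code_conf y = r.
  by apply: funext => s; apply: funext => k; rewrite /code_conf yE /= odd_double uphalf_double.
move=> cert; exists y; split; last exact: conf_eq.
split; [exact: erefl| |by rewrite lt_eq conf_eq].
by move=> s t; rewrite yE odd_double leq_b1.
Qed.

Ltac comp_var :=
  first [ exact: comp_var0
        | exact: (comp_wk (comp_var0 _))
        | exact: (comp_wk (comp_wk (comp_var0 _)))
        | exact: (comp_wk (comp_wk (comp_wk (comp_var0 _)))) ].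

Ltac comp_hyp :=
  match goal with
  | H : computable _ |- _ =>
    first [ exact: H | exact: (comp_wk H) | exact: (comp_wk (comp_wk H))
          | exact: (comp_wk (comp_wk (comp_wk H))) ]
  | H : is_fvar _ |- _ =>
    first [ exact: H | exact: (is_fvar_wk H) | exact: (is_fvar_wk (is_fvar_wk H))
          | exact: (is_fvar_wk (is_fvar_wk (is_fvar_wk H))) ]
  end.

Lemma compP_and3 (c : ctx) (P Q S : c -> Prop) :
  computable_pred P -> computable_pred Q -> computable_pred S ->
    computable_pred (fun g => [/\ P g, Q g & S g]).
Proof.
move=> HP HQ HS; apply: compP_ext (compP_and HP (compP_and HQ HS)) => g.
by split=> [[? []]|[]].
Qed.

Lemma compP_and4 (c : ctx) (P Q S U : c -> Prop) :
  computable_pred P -> computable_pred Q -> computable_pred S -> computable_pred U ->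
    computable_pred (fun g => [/\ P g, Q g, S g & U g]).
Proof.
move=> HP HQ HS HU; apply: compP_ext (compP_and HP (compP_and3 HQ HS HU)) => g.
by split=> [[? []]|[]].
Qed.

Lemma compP_and5 (c : ctx) (P Q S U V : c -> Prop) :
  computable_pred P -> computable_pred Q -> computable_pred S -> computable_pred U ->
    computable_pred V ->
  computable_pred (fun g => [/\ P g, Q g, S g, U g & V g]).
Proof.
move=> HP HQ HS HU HV; apply: compP_ext (compP_and HP (compP_and4 HQ HS HU HV)) => g.
by split=> [[? []]|[]].
Qed.

Lemma compP_or4 (c : ctx) (P Q S U : c -> Prop) :
  computable_pred P -> computable_pred Q -> computable_pred S -> computable_pred U ->
    computable_pred (fun g => [\/ P g, Q g, S g | U g]).
Proof.
move=> HP HQ HS HU; apply: compP_ext (compP_or HP (compP_or HQ (compP_or HS HU))) => g.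
split=> [[|[|[]]]|[]]; try by [apply: Or41|apply: Or42|apply: Or43|apply: Or44]; tauto.
Qed.

(* Redefined below as computability lemmas for named predicates accumulate. *)
Ltac comp_named := fail.
Ltac comp_step :=
  cbv beta;
  first [ comp_var | comp_hyp | exact: comp_const | comp_named
        | apply: compP_forall | apply: compP_exists
        | apply: compP_not | apply: compP_and | apply: compP_and3 | apply: compP_and4
        | apply: compP_and5 | apply: compP_or | apply: compP_or4 | apply: compP_imp
        | apply: compP_eq | apply: compP_leq
        | apply: comp_if | apply: comp_cpair | apply: comp_cnth | apply: comp_csize
        | apply: comp_double | apply: comp_succ | apply: comp_pred
        | apply: comp_add | apply: comp_mul | apply: comp_app ].
Ltac comp_auto := repeat comp_step.

Lemma compP_lt (c : ctx) (Y : c -> nat -> nat) (S T : c -> nat) :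
  is_fvar Y -> computable S -> computable T -> computable_pred (fun g => code_lt (Y g)
    (S g) (T g)).
Proof. by move=> HY HS HT; rewrite /code_lt; comp_auto. Qed.

Lemma comp_conf (c : ctx) (Y : c -> nat -> nat) (S K : c -> nat) :
  is_fvar Y -> computable S -> computable K -> computable (fun g => code_conf (Y g) (S g)
    (K g)).
Proof. by move=> HY HS HK; rewrite /code_conf; comp_auto. Qed.

Ltac comp_named ::= first [apply: compP_lt | apply: comp_conf].

Lemma compP_zero (c : ctx) (Y : c -> nat -> nat) (A : c -> nat) :
  is_fvar Y -> computable A -> computable_pred (fun g => zero (code_lt (Y g)) (A g)).
Proof. by move=> HY HA; rewrite /zero; comp_auto. Qed.

Lemma compP_succ (c : ctx) (Y : c -> nat -> nat) (A B : c -> nat) :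
  is_fvar Y -> computable A -> computable B ->
    computable_pred (fun g => succ (code_lt (Y g)) (A g) (B g)).
Proof. by move=> HY HA HB; rewrite /succ; comp_auto. Qed.

Ltac comp_named ::= first [apply: compP_lt | apply: comp_conf | apply: compP_zero |
  apply: compP_succ].

Lemma compP_limit (c : ctx) (Y : c -> nat -> nat) (A : c -> nat) :
  is_fvar Y -> computable A -> computable_pred (fun g => limit (code_lt (Y g)) (A g)).
Proof. by move=> HY HA; rewrite /limit; comp_auto. Qed.

Lemma compP_cofinal (c : ctx) (Y : c -> nat -> nat) (A K : c -> nat) :
  is_fvar Y -> computable A -> computable K ->
  computable_pred (fun g => cofinal (code_lt (Y g)) (code_conf (Y g)) (A g) (K g)).
Proof. by move=> HY HA HK; rewrite /cofinal; comp_auto. Qed.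

Lemma comp_limit_conf (c : ctx) (Y : c -> nat -> nat) (A K : c -> nat) :
  is_fvar Y -> computable A -> computable K ->
  computable (fun g => limit_conf (code_lt (Y g)) (code_conf (Y g)) (A g) (K g)).
Proof.
move=> HY HA HK; apply: comp_ext (comp_if (compP_eq0 HK) (comp_const c 1)
  (comp_if (compP_eq HK (comp_const c 1)) (comp_const c 0) (compP_cofinal HY HA HK))) => g.
case: (K g) => [|[|k]]; first by rewrite asboolT.
  by rewrite asboolF // asboolT.
by rewrite asboolF // asboolF.
Qed.

Lemma comp_init_conf (c : ctx) (N K : c -> nat) :
  computable N -> computable K -> computable (fun g => init_conf (N g) (K g)).
Proof.
move=> HN HK; change (computable_pred (fun g => exists i, i < N g /\ K g = i * 3 + 2)).
by comp_auto.
Qed.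

Lemma comp_step_conf (c : ctx) (E : c -> nat) (Y : c -> nat -> nat) (A K : c -> nat) :
  computable E -> is_fvar Y -> computable A -> computable K ->
  computable (fun g => step_conf (E g) (code_conf (Y g) (A g)) (K g)).
Proof.
move=> HE HY HA HK.
pose p g := code_conf (Y g) (A g) 1 * 3 + 2.
have Hp : computable p by rewrite /p; comp_auto.
pose C := fun g => code_conf (Y g) (A g).
pose t g := cnth (E g) (1 + C g 0 * 8 + (4 * C g (p g) + 2 * C g (p g).+1 + C g (p g).+2)).
have Ht : computable t by rewrite /t /C; comp_auto.
change (computable (fun g =>
  if `[< K g = 0 >] then cnth (t g) 0 else
  if `[< K g = 1 >] then if `[< cnth (t g) 4 = 0 >] then (code_conf (Y g) (A g) 1).-1
                         else (code_conf (Y g) (A g) 1).+1 else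
  if `[< K g = p g >] then cnth (t g) 1 else
  if `[< K g = (p g).+1 >] then cnth (t g) 2 else
  if `[< K g = (p g).+2 >] then cnth (t g) 3 else code_conf (Y g) (A g) (K g))).
by comp_auto.
Qed.

Ltac comp_named ::=
  first [ apply: compP_lt | apply: comp_conf | apply: compP_zero | apply: compP_succ
        | apply: compP_limit | apply: compP_cofinal | apply: comp_limit_conf
        | apply: comp_init_conf | apply: comp_step_conf ].

Lemma compP_run (c : ctx) (E N : c -> nat) (Y : c -> nat -> nat) :
  computable E -> computable N -> is_fvar Y ->
  computable_pred (fun g => run (code_lt (Y g)) (init_conf (N g)) (step_conf (E g))
    (code_conf (Y g))).
Proof. by move=> HE HN HY; rewrite /run; comp_auto. Qed.

(** Well-foundedness takes a genuine path quantifier: no path runs through the finite descending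
    sequences singled out by [Q]. *)
Lemma compP_pwo (c : ctx) (Y : c -> nat -> nat) :
  is_fvar Y -> computable_pred (fun g => pwo (code_lt (Y g))).
Proof.
move=> HY.
pose Q s g := forall i, i.+1 < size s -> code_lt (Y g) (nth 0 s i.+1) (nth 0 s i).
have /compP_suslin HQ : computable_pred (fun p : npush c => Q (CodeSeq.decode p.1) p.2).
  change (computable_pred (fun p : npush c => forall i, i.+1 < csize p.1 ->
    code_lt (Y p.2) (cnth p.1 i.+1) (cnth p.1 i))).
  by comp_auto.
have Hcot : computable_pred (fun g => forall a b d, code_lt (Y g) a b -> code_lt (Y g)
  a d \/ code_lt (Y g) d b).
  by comp_auto.
apply: compP_ext (compP_and (compP_not HQ) Hcot) => g.
rewrite /pwo well_founded_no_chain; suff -> : (exists h, forall n, Q (mkseq h n) g) <->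
  exists h, forall i, code_lt (Y g) (h i.+1) (h i) by [].
split=> -[h hP]; exists h; last first.
  by move=> n i; rewrite size_mkseq => lt_i; rewrite !nth_mkseq ?(ltnW lt_i).
by move=> i; have := hP i.+2 i; rewrite size_mkseq !nth_mkseq //; apply.
Qed.

Lemma compP_on (c : ctx) (Y : c -> nat -> nat) (S K : c -> nat) :
  is_fvar Y -> computable S -> computable K ->
    computable_pred (fun g => on (code_conf (Y g) (S g)) (K g)).
Proof. by move=> HY HS HK; rewrite /on; comp_auto. Qed.

Lemma compP_loop (c : ctx) (Y : c -> nat -> nat) (A B : c -> nat) :
  is_fvar Y -> computable A -> computable B ->
  computable_pred (fun g => loop (code_lt (Y g)) (code_conf (Y g)) (A g) (B g)).
Proof. by move=> HY HA HB; rewrite /loop; comp_auto. Qed.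

Ltac comp_named ::=
  first [ apply: compP_lt | apply: comp_conf | apply: compP_zero | apply: compP_succ
        | apply: compP_limit | apply: compP_cofinal | apply: comp_limit_conf
        | apply: comp_init_conf | apply: comp_step_conf | apply: compP_run
        | apply: compP_pwo | apply: compP_on | apply: compP_loop ].

Lemma compP_ended (c : ctx) (Y : c -> nat -> nat) (A : c -> nat) :
  is_fvar Y -> computable A -> computable_pred (fun g => ended (code_lt (Y g))
    (code_conf (Y g)) (A g)).
Proof. by move=> HY HA; rewrite /ended; comp_auto. Qed.

Lemma compP_phi (c : ctx) (Y : c -> nat -> nat) (J S T K D : c -> nat) :
  is_fvar Y -> computable J -> computable S -> computable T -> computable K -> computable D ->
  computable_pred (fun g => phi (code_lt (Y g)) (code_conf (Y g)) 0 (J g) (S g) (T g)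
    (K g) (D g)).
Proof. by move=> HY HJ HS HT HK HD; rewrite /phi; comp_auto. Qed.

Ltac comp_named ::=
  first [ apply: compP_lt | apply: comp_conf | apply: compP_run
        | apply: compP_pwo | apply: compP_ended | apply: compP_phi ].

Lemma compP_denotes (c : ctx) (Y : c -> nat -> nat) (J S T K U : c -> nat) :
  is_fvar Y -> computable J -> computable S -> computable T -> computable K -> computable U ->
  computable_pred (fun g => denotes (code_lt (Y g)) (code_conf (Y g)) 0 (J g) (S g) (T g)
    (K g) (U g)).
Proof. by move=> HY HJ HS HT HK HU; rewrite /denotes /least; comp_auto. Qed.

Ltac comp_named ::=
  first [ apply: compP_lt | apply: comp_conf | apply: compP_run
        | apply: compP_pwo | apply: compP_ended | apply: compP_denotes ].

Lemma compP_code_of_certificate (c : ctx) (E N : c -> nat) (Y : c -> nat -> nat) :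
  computable E -> computable N -> is_fvar Y ->
  computable_pred (fun g => code_of_certificate (E g) (N g) (Y g)).
Proof.
move=> HE HN HY.
have HY2 : computable (fun g : npush (npush c) => Y g.2.2 (cpair g.2.1 g.1.*2)).
  by apply: (comp_app (is_fvar_wk (is_fvar_wk HY))); comp_auto.
by rewrite /code_of_certificate /ittm_certificate /certificate /least; comp_auto.
Qed.

Lemma compP_valid (c : ctx) (E : c -> nat) : computable E ->
  computable_pred (fun g => valid (E g)).
Proof. by move=> HE; rewrite /valid; comp_auto. Qed.

(** * Halting of machines *)

(* Omega_1 is applied to the set of codes of certificates, which is a singleton. *)
Lemma certificate_computable (c : ctx) (E N : c -> nat) :
  computable E -> computable N -> (forall g, exists M, ittm_code M = E g) ->
  exists x : c -> nat -> nat,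
    (forall g, code_of_certificate (E g) (N g) (x g)) /\
    forall K, computable K -> computable (fun g => x g (K g)).
Proof.
move=> HE HN codes.
have ex g : exists y, code_of_certificate (E g) (N g) y.
  have [M <-] := codes g; have [lt [r [cert _]]] := certificate_exists M (N g).
  by have [y [yP _]] := code_of_certificate_exists cert; exists y.
have [x xP] := choice ex; exists x; split=> // K HK.
have HF : computable_pred (fun p : fpush c => code_of_certificate (E p.2) (N p.2) p.1).
  exact: compP_code_of_certificate (comp_fwk HE) (comp_fwk HN) (is_fvar0 c).
apply: (comp_Omega1 HF HK) => g y; congr nat_of_bool; apply: asbool_equiv_eq.
by split=> [yP|->]; [apply: code_of_certificate_unique yP (xP g)|apply: xP].
Qed.

Theorem theorem3p32 :
  (forall A : nat -> bool,
     ittm_computable A -> computable_in (char1 A) [:: Omega1; suslin]) /\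
  computable_in (char2 ittm_halting) [:: Omega1; suslin].
Proof.
split=> [A [M MA]|].
  have [_|x [xP xC]] := @certificate_computable (npush ctx0)
    (fun=> ittm_code M) (fun g => g.1) (comp_const _ _) (comp_var0 _).
    by exists M.
  (* Entry 4 of the top configuration is output cell 0, which carries the answer [A n]. *)
  have [e eP] := xC _ (comp_const _ (cpair 0 4.*2.+1)).
  exists e => -[n []] a [<-].
  have [_ _ cert] := xP (n, tt); have [_ /(_ 0) out] := certificate_halts cert (MA n).
  have := eP (n, tt); rewrite -[x _ _]/(code_conf (x (n, tt)) 0 (0 * 3 + 4)) out /numeral.
  by case: (A n).
(* Numbers that code no machine are replaced by the code of [M0], so that [Omega1] is applied to a
   singleton for all arguments. *)
pose M0 := @Ittm 0 (fun q x => (q, x, true)).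
pose E (g : npush (npush ctx0)) := if `[< valid g.1 >] then g.1 else ittm_code M0.
have HE : computable E.
  exact: comp_if (compP_valid (comp_var0 _)) (comp_var0 _) (comp_const _ _).
have [g|x [xP xC]] := certificate_computable HE (comp_wk (comp_var0 ctx0)).
  by rewrite /E; case: asboolP => [/validP//|_]; exists M0.
have [e eP] := compP_and (compP_valid (comp_var0 _))
  (compP_eq (xC _ (comp_const _ (cpair 0 0.*2.+1))) (comp_const _ 2)).
exists e => -[m [n []]] a [<-]; have := eP (m, (n, tt)).
suff -> : `[< ittm_halting m n >] =
    `[< valid m /\ x (m, (n, tt)) (cpair 0 0.*2.+1) = 2 >] by [].
apply: asbool_equiv_eq; have [_ _] := xP (m, (n, tt)); rewrite /E /=.
rewrite -[x _ _]/(code_conf (x (m, (n, tt))) 0 0) => cert.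
split=> [[M [Mm [T halts_T]]]|[m_ok halted]].
  have m_ok : valid m by rewrite -Mm; apply: valid_ittm_code.
  split=> //; subst m; rewrite asboolT // in cert.
  by have [] := certificate_halts cert halts_T.
have [M Mm] := validP m_ok; exists M; split=> //; subst m.
(* By uniqueness the computed certificate is the one of an actual run, whose halting at the top
   yields [halts]. *)
have [lt [r [cert' halts_M]]] := certificate_exists M n.
rewrite asboolT // in cert.
have [_ r_eq] := certificate_unique cert cert'.
by apply: halts_M; rewrite -r_eq.
Qed.
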